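(* Run the method RR-sc with the blockwise step sizes $\alpha_t=\alpha_{\rm sc}^{(k)}$ for $t\in\{T_k,\dots,T_k+S_k-1\}$, $k=0,1,2,\dots$ (all defined in the context). Then, with probability at least $1-\delta$, the number of stochastic gradient evaluations needed to trigger the stopping criterion $\|g_t\|\le\eta\varepsilon$ satisfies $$n\tau=\tilde{\mathcal O}\left(\max\left\{\sqrt n\,(\eta\varepsilon)^{-3},\ n(\eta\varepsilon)^{-2}\right\}\right).$$
   Context: Problem: $f(x)=\frac1n\sum_{i=1}^n f_i(x)$ on $\mathbb{R}^d$. Each $f_i:\mathbb{R}^d\to\mathbb{R}$ is continuously differentiable (not necessarily convex), bounded from below by $\bar f_i\in\mathbb{R}$, and $\nabla f_i$ is Lipschitz continuous with parameter $L>0$. Let $\bar f$ be a lower bound of $f$ (e.g. its optimal value), and set $A=2L>0$ and $B=\frac{A}{n}\sum_{i=1}^n(\bar f-\bar f_i)$, with $\bar f$ such that $B\ge0$ (automatic if $\bar f=\inf f$). Set $F:=3(f(x_0)-\bar f)+3B/A\ge0$. $\|\cdot\|$ is the Euclidean norm. RR-sc with tolerance $\eta>0$ and accuracy $\varepsilon>0$: let $\Pi$ be the set of all permutations of $\{1,\dots,n\}$. Starting from a deterministic $x_0$, at epoch $t=0,1,\dots$ a permutation $\pi_t=(\pi_t^1,\dots,\pi_t^n)$ is sampled uniformly at random from $\Pi$, independently of the past; set $x_t^0=x_t$, $x_t^i=x_t^{i-1}-\alpha_t\nabla f_{\pi_t^i}(x_t^{i-1})$ for $i=1,\dots,n$,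 and $g_t=\frac1n\sum_{i=1}^n\nabla f_{\pi_t^i}(x_t^{i-1})$. If $\|g_t\|\le\eta\varepsilon$, the method stops, sets $\tau=t$ and returns $x_\tau$; otherwise $x_{t+1}=x_t^n$ and it continues. Thus $\tau$ is the first $t$ with $\|g_t\|\le\eta\varepsilon$ ($\tau=\infty$ if there is none). Blockwise step sizes: let $\delta\in(0,1)$. For $k=0,1,2,\dots$ let $S_k=2^k$, $T_k=\sum_{j=0}^{k-1}S_j=2^k-1$ ($T_0=0$), $\delta_k=\frac{6\delta}{\pi^2(k+1)^2}$ (here $\pi=3.14\ldots$), $\ell_k=\log(8nS_k/\delta_k)$, and $$\alpha_t=\alpha_{\rm sc}^{(k)}:=\min\left\{\frac1{4nL},\ \frac{\eta\varepsilon}{8\sqrt{nAF}\,L\,\ell_k}\right\},\qquad t\in\{T_k,\dots,T_k+S_k-1\},$$ where the second term is read as $+\infty$ if $F=0$. Complexity notation: $\tilde{\mathcal O}$ hides problem constants and logarithmic factors in $n$, $1/\delta$, $1/\varepsilon$ ($\eta$ being a constant). Precisely: there are an absolute constant $p$ and a constant $C$ depending only on $L$, $f(x_0)-\bar f$ and $B$ such that, whenever $0<\eta\varepsilon\le1$, with probability at least $1-\delta$, $n\tau\le C\max\{\sqrt n(\eta\varepsilon)^{-3},n(\eta\varepsilon)^{-2}\}\,(1+\log n+\log(1/\delta)+\log(1/(\eta\varepsilon)))^p$. *)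

(* Defs.v *)
From HB Require Import structures.
From mathcomp Require Import all_boot all_order all_algebra all_fingroup.
From mathcomp Require Import all_classical all_reals all_analysis.
Set Implicit Arguments.
Unset Strict Implicit.
Unset Printing Implicit Defensive.
Import Order.TTheory GRing.Theory Num.Theory.
Import numFieldNormedType.Exports.
Local Open Scope classical_set_scope.
Local Open Scope ring_scope.

(* The library norm `|x| on 'rV[R]_d is the sup norm. *)
Definition enorm {R : realType} {d : nat} (x : 'rV[R]_d) : R :=
  Num.sqrt (\sum_j x 0 j ^+ 2).

Definition grad {R : realType} {d : nat} (h : 'rV[R]_d -> R) (x : 'rV[R]_d) :
  'rV[R]_d := \row_j 'D_(delta_mx 0 j) h x.

Definition cont_differentiable {R : realType} {d : nat} (h : 'rV[R]_d -> R) :=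
  (forall x, differentiable h x) /\ continuous (grad h).

Definition grad_lipschitz {R : realType} {d : nat} (L : R)
    (h : 'rV[R]_d -> R) :=
  forall x y, enorm (grad h x - grad h y) <= L * enorm (x - y).

Definition favg {R : realType} {n d : nat} (f : 'I_n -> 'rV[R]_d -> R)
  (x : 'rV[R]_d) : R := n%:R^-1 * \sum_(i < n) f i x.

Definition cstA {R : realType} (L : R) : R := 2 * L.

Definition cstB {R : realType} {n : nat} (L fbar : R) (fbars : 'I_n -> R) : R :=
  cstA L / n%:R * \sum_(i < n) (fbar - fbars i).

Definition cstF {R : realType} {n d : nat} (L : R) (f : 'I_n -> 'rV[R]_d -> R)
    (fbar : R) (fbars : 'I_n -> R) (x0 : 'rV[R]_d) : R :=
  3 * (favg f x0 - fbar) + 3 * cstB L fbar fbars / cstA L.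

Definition blockS (k : nat) : nat := (2 ^ k)%N.

Definition blockT (k : nat) : nat := (\sum_(j < k) blockS j)%N.

Definition delta_blk {R : realType} (delta : R) (k : nat) : R :=
  6 * delta / (pi ^+ 2 * k.+1%:R ^+ 2).

Definition ell_blk {R : realType} (n : nat) (delta : R) (k : nat) : R :=
  ln (8 * n%:R * (blockS k)%:R / delta_blk delta k).

(* The case F = 0 is separated because x / 0 = 0 here, whereas the second term
   of the minimum must then be read as +oo. *)
Definition alpha_sc {R : realType} (n : nat) (L F eta eps delta : R) (k : nat) :
  R :=
  if F == 0 then (4 * n%:R * L)^-1
  else Num.min ((4 * n%:R * L)^-1)
    (eta * eps / (8 * Num.sqrt (n%:R * cstA L * F) * L * ell_blk n delta k)).

(* Components are numbered from 0: rr_inner f a s x i is x_t^i for x = x_t,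
   a = alpha_t and s = pi_t, i.e. the point reached after the gradient steps
   along f_(s 0), ..., f_(s (i - 1)). *)
Definition rr_inner {R : realType} {n d : nat} (f : 'I_n -> 'rV[R]_d -> R)
    (a : R) (s : 'S_n) (x : 'rV[R]_d) (i : nat) : 'rV[R]_d :=
  foldl (fun y j => y - a *: grad (f (s j)) y) x (take i (enum 'I_n)).

(* The iterates are defined for all epochs, ignoring the stopping rule: up to
   and including the stopping epoch they are those of the stopped method. *)
Fixpoint rr_iter {R : realType} {n d : nat} (f : 'I_n -> 'rV[R]_d -> R)
    (alpha : nat -> R) (s : nat -> 'S_n) (x0 : 'rV[R]_d) (t : nat) : 'rV[R]_d :=
  if t is t'.+1 then
    rr_inner f (alpha t') (s t') (rr_iter f alpha s x0 t') n
  else x0.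

Definition rr_g {R : realType} {n d : nat} (f : 'I_n -> 'rV[R]_d -> R)
    (alpha : nat -> R) (s : nat -> 'S_n) (x0 : 'rV[R]_d) (t : nat) : 'rV[R]_d :=
  n%:R^-1 *: \sum_(i < n)
    grad (f (s t i)) (rr_inner f (alpha t) (s t) (rr_iter f alpha s x0 t) i).

(* The first epoch t with |g_t| <= tol; the infimum of the empty set is +oo. *)
Definition rr_tau {R : realType} {n d : nat} (f : 'I_n -> 'rV[R]_d -> R)
    (alpha : nat -> R) (s : nat -> 'S_n) (x0 : 'rV[R]_d) (tol : R) : \bar R :=
  ereal_inf [set t%:R%:E | t in [set t | enorm (rr_g f alpha s x0 t) <= tol]].

(* Each pi_t is a uniform random permutation, independent of
   (pi_0, ..., pi_(t-1)); all subsets of the finite value spaces are taken as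
   measurable. *)
Definition uniform_reshuffling {R : realType} {dsp : measure_display}
    {W : measurableType dsp} (P : probability W R) {n : nat}
    (perms : nat -> W -> 'S_n) :=
  [/\ forall t (s : 'S_n), measurable [set w | perms t w = s],
      forall t (s : 'S_n), P [set w | perms t w = s] = (n`!%:R^-1)%:E
    & forall t (A : set (t.-tuple 'S_n)) (B : set 'S_n),
        P [set w | A [tuple perms i w | i < t] /\ B (perms t w)] =
        (P [set w | A [tuple perms i w | i < t]] * P [set w | B (perms t w)])%E].

(* Main.v *)
Require Import Defs.
From HB Require Import structures.
From mathcomp Require Import all_boot all_order all_algebra all_fingroup.
From mathcomp Require Import all_classical all_reals all_analysis.
From mathcomp Require Import zify ring lra.
Set Implicit Arguments.
Unset Strict Implicit.
Unset Printing Implicit Defensive.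
Import Order.TTheory GRing.Theory Num.Theory.
Import numFieldNormedType.Exports.
Local Open Scope classical_set_scope.
Local Open Scope ring_scope.

(* If the prefix sums Z_i of the centred gradients along pi_t satisfy
   alpha_t L |Z_i| <= eta eps / 2, then g_t is so close to the gradient of f that
   an epoch which does not stop decreases f by n alpha_t (eta eps)^2 / 8. Hence
   f (x_t) <= f (x_0) until stopping, which bounds the sum of the squared centred
   gradients by n A F / 3, and in the first block K with
   2^K alpha_K n (eta eps)^2 / 8 > f (x_0) - fbar the method must have stopped.

   For a random order, the prefix sums are controlled by the potential
   exp (sqrt (1 + |Z|^2)): averaging over the next draw multiplies its mean by at
   most 1 + 1 / (n - i), so after i < n draws it has grown by (n + 1) / 2 at most,
   whatever the dimension. Markov's inequality then bounds the failure
   probability of epoch t by delta / ((t + 1) (t + 2)), which sums to delta. *)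

(** * Euclidean geometry *)

Definition dot {R : realType} {d : nat} (x y : 'rV[R]_d) : R :=
  \sum_j x 0 j * y 0 j.

Lemma dotC (R : realType) d (x y : 'rV[R]_d) : dot x y = dot y x.
Proof. by apply: eq_bigr => j _; rewrite mulrC. Qed.

Lemma dotDl (R : realType) d (x y z : 'rV[R]_d) :
  dot (x + y) z = dot x z + dot y z.
Proof. by rewrite -big_split; apply: eq_bigr => j _; rewrite mxE mulrDl. Qed.

Lemma dotDr (R : realType) d (x y z : 'rV[R]_d) :
  dot z (x + y) = dot z x + dot z y.
Proof. by rewrite !(dotC z) dotDl. Qed.

Lemma dotZl (R : realType) d (a : R) (x y : 'rV[R]_d) :
  dot (a *: x) y = a * dot x y.
Proof. by rewrite mulr_sumr; apply: eq_bigr => j _; rewrite mxE mulrA. Qed.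

Lemma dotZr (R : realType) d (a : R) (x y : 'rV[R]_d) :
  dot y (a *: x) = a * dot y x.
Proof. by rewrite !(dotC y) dotZl. Qed.

Lemma dotNl (R : realType) d (x y : 'rV[R]_d) : dot (- x) y = - dot x y.
Proof. by rewrite -scaleN1r dotZl mulN1r. Qed.

Lemma dotNr (R : realType) d (x y : 'rV[R]_d) : dot y (- x) = - dot y x.
Proof. by rewrite !(dotC y) dotNl. Qed.

Lemma dot0r (R : realType) d (x : 'rV[R]_d) : dot x 0 = 0.
Proof. by rewrite -(scale0r 0) dotZr mul0r. Qed.

Lemma dot_sumr (R : realType) d (I : Type) (r : seq I) (P : pred I)
    (F : I -> 'rV[R]_d) (x : 'rV[R]_d) :
  dot x (\sum_(i <- r | P i) F i) = \sum_(i <- r | P i) dot x (F i).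
Proof. exact: (big_morph (dot x) (fun a b => dotDr a b x) (dot0r x)). Qed.

Lemma dot_ge0 (R : realType) d (x : 'rV[R]_d) : 0 <= dot x x.
Proof. by apply: sumr_ge0 => j _; rewrite -expr2 sqr_ge0. Qed.

Lemma dot_eq0 (R : realType) d (x : 'rV[R]_d) : dot x x = 0 -> x = 0.
Proof.
move=> x0; apply/rowP => j; rewrite mxE.
have /psumr_eq0P : forall j, true -> 0 <= x 0 j * x 0 j.
  by move=> i _; rewrite -expr2 sqr_ge0.
by move=> /(_ x0 j isT)/eqP; rewrite mulf_eq0 => /orP[]/eqP.
Qed.

Lemma dot_subr_sqr (R : realType) d (x y : 'rV[R]_d) :
  dot (x - y) (x - y) = dot x x - 2 * dot y x + dot y y.
Proof. by rewrite !(dotDl, dotDr, dotNl, dotNr) (dotC x y); ring. Qed.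

Lemma enormE (R : realType) d (x : 'rV[R]_d) : enorm x = Num.sqrt (dot x x).
Proof. by congr Num.sqrt; apply: eq_bigr => j _; rewrite expr2. Qed.

Lemma enorm_ge0 (R : realType) d (x : 'rV[R]_d) : 0 <= enorm x.
Proof. exact: sqrtr_ge0. Qed.

Lemma enorm_sqr (R : realType) d (x : 'rV[R]_d) : enorm x ^+ 2 = dot x x.
Proof. by rewrite enormE sqr_sqrtr ?dot_ge0. Qed.

Lemma dot_le_enorm (R : realType) d (x y : 'rV[R]_d) :
  dot x y <= enorm x * enorm y.
Proof.
have hx := enorm_ge0 x; have hy := enorm_ge0 y.
have key : dot x y ^+ 2 <= enorm x ^+ 2 * enorm y ^+ 2.
  have := dot_ge0 (dot y y *: x - dot x y *: y).
  rewrite !(dotDl, dotDr, dotNl, dotNr, dotZl, dotZr) (dotC y x) !enorm_sqr.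
  have := dot_ge0 y; rewrite le0r => /orP[/eqP y0|y_gt0 h]; last first.
    rewrite -subr_ge0 -(pmulr_rge0 _ y_gt0).
    by apply: le_trans h _; rewrite le_eqVlt; apply/orP; left; apply/eqP; ring.
  by move=> _; rewrite (dot_eq0 y0) !dot0r mulr0 expr0n.
rewrite -exprMn in key.
apply: le_trans (ler_norm _) _.
by rewrite -ler_sqr ?nnegrE ?mulr_ge0// real_normK ?num_real.
Qed.

Lemma enormN (R : realType) d (x : 'rV[R]_d) : enorm (- x) = enorm x.
Proof. by rewrite !enormE dotNl dotNr opprK. Qed.

Lemma enormZ (R : realType) d (a : R) (x : 'rV[R]_d) :
  enorm (a *: x) = `|a| * enorm x.
Proof.
by rewrite !enormE dotZl dotZr mulrA -expr2 sqrtrM ?sqr_ge0// sqrtr_sqr.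
Qed.

Lemma enorm0 (R : realType) d : enorm (0 : 'rV[R]_d) = 0.
Proof. by rewrite enormE dot0r sqrtr0. Qed.

Lemma enormD (R : realType) d (x y : 'rV[R]_d) :
  enorm (x + y) <= enorm x + enorm y.
Proof.
rewrite -ler_sqr ?nnegrE ?addr_ge0 ?enorm_ge0//.
rewrite sqrrD !enorm_sqr !(dotDl, dotDr) (dotC y x).
by have := dot_le_enorm x y; lra.
Qed.

Lemma enorm_sum (R : realType) d (I : Type) (r : seq I) (P : pred I)
    (F : I -> 'rV[R]_d) :
  enorm (\sum_(i <- r | P i) F i) <= \sum_(i <- r | P i) enorm (F i).
Proof.
elim/big_ind2: _ => [|x a y b ha hb|//]; first by rewrite enorm0.
by apply: le_trans (enormD _ _) _; exact: lerD.
Qed.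

(** * Smoothness *)

Lemma diff_dot_grad (R : realType) d (h : 'rV[R]_d -> R) (x v : 'rV[R]_d) :
  differentiable h x -> 'd h x v = dot (grad h x) v.
Proof.
move=> dh; rewrite {1}(row_sum_delta v) linear_sum; apply: eq_bigr => j _.
by rewrite linearZ /= -deriveE// mxE mulrC.
Qed.

Lemma is_derive_line (R : realType) (V : normedModType R) (h : V -> R)
    (x v : V) (t : R) :
  (forall y, differentiable h y) ->
  is_derive t (1 : R) (fun t : R => h (x + t *: v)) ('d h (x + t *: v) v).
Proof.
move=> dh.
have dl : is_diff t (cst x + *:%R^~ v) ( *:%R^~ v).
  have := is_diffD (is_diff_cst x t) (is_diff_scalel t v).
  by rewrite add0r.
have dhl : is_diff (x + t *: v) h ('d h (x + t *: v)) by exact: DiffDef.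
have dc := is_diff_comp dl dhl.
have dd := @ex_diff _ _ _ _ _ _ _ dc.
apply: DeriveDef; first exact: diff_derivable.
rewrite (deriveE _ dd).
by rewrite (@diff_val _ _ _ _ _ _ _ dc) /= scale1r.
Qed.

(** The mean value theorem is applied to [p] minus the quadratic with derivative [b + c * t]. The
    mean value point is interior, so the bound on [dp] is asked for [0 < t] only. *)
Lemma quadratic_upper_bound (R : realType) (p dp : R -> R) (b c : R) :
  (forall t : R, is_derive t (1 : R) p (dp t)) ->
  (forall t, 0 < t -> dp t <= b + c * t) -> p 1 <= p 0 + b + c / 2.
Proof.
move=> pdp dple.
pose q : R -> R := p - (b *: (id : R -> R) + (c / 2) *: (id ^+ 2 : R -> R))%R.
have dq (t : R) : is_derive t (1 : R) q (dp t - (b + c * t)).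
  have did := is_derive_id t (1 : R).
  have dq := is_deriveB (pdp t)
    (is_deriveD (is_deriveZ b did) (is_deriveZ (c / 2) (is_deriveX 2 did))).
  apply: (@is_derive_eq _ _ _ _ _ _ _ _ dq).
  rewrite /GRing.scale /= !mulr1 expr1; congr (_ - (_ + _)).
  by field.
have cq : {within `[0, 1], continuous q}.
  by apply: derivable_within_continuous => t _; case: (dq t).
have [t] := MVT ltr01 (fun t _ => dq t) cq.
rewrite in_itv /= => /andP[t0 _]; rewrite subr0 mulr1.
have := dple t t0.
rewrite /q !fctE /= /GRing.scale /= expr1n expr0n /= !mulr1 !mulr0 !addr0.
by lra.
Qed.

(** Along the segment, Cauchy-Schwarz and the Lipschitz gradient bound the slope of
    [t |-> h (x + t v)] by an affine function of [t]; [quadratic_upper_bound] then replaces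
    integration. *)
Lemma descent (R : realType) d (L : R) (h : 'rV[R]_d -> R) (x v : 'rV[R]_d) :
  (forall y, differentiable h y) -> grad_lipschitz L h ->
  h (x + v) <= h x + dot (grad h x) v + L / 2 * dot v v.
Proof.
move=> dh lip.
have key t : 0 < t ->
    'd h (x + t *: v) v <= dot (grad h x) v + L * dot v v * t.
  move=> t0; rewrite diff_dot_grad// -lerBlDl.
  rewrite -dotNl -dotDl; apply: le_trans (dot_le_enorm _ _) _.
  have -> : L * dot v v * t = L * enorm (t *: v) * enorm v.
    by rewrite enormZ (ger0_norm (ltW t0)) -enorm_sqr; ring.
  apply: ler_wpM2r; first exact: enorm_ge0.
  by apply: le_trans (lip _ _) _; rewrite addrAC subrr add0r.
have := quadratic_upper_bound (fun t => is_derive_line x v t dh) key.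
by rewrite scale1r scale0r addr0 mulrAC.
Qed.

(** A gradient step of size [1 / L] lowers [h] by at least [|grad h x|^2 / (2 L)], yet cannot go
    below [m]. *)
Lemma sqr_grad_le (R : realType) d (L m : R) (h : 'rV[R]_d -> R)
    (x : 'rV[R]_d) :
  0 < L -> (forall y, differentiable h y) -> grad_lipschitz L h ->
  (forall y, m <= h y) -> dot (grad h x) (grad h x) <= 2 * L * (h x - m).
Proof.
move=> L0 dh lip hm.
have := descent x (- (L^-1 *: grad h x)) dh lip.
have := hm (x + - (L^-1 *: grad h x)).
rewrite !(dotNr, dotNl, dotZr, dotZl); set g := dot _ _ => h1 h2.
have {h1 h2} := le_trans h1 h2.
have -> : h x - L^-1 * g + L / 2 * - - (L^-1 * (L^-1 * g)) = h x - g / (2 * L).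
  by field; rewrite gt_eqF.
by rewrite -(ler_pdivrMl _ _ (_ : 0 < 2 * L)) ?mulr_gt0// mulrC; lra.
Qed.

(** * One epoch *)

(** For differentiable components this is the gradient of [favg f]. The explicit form lets
    [favg_descent] follow by averaging [descent]. *)
Definition mean_grad {R : realType} {n d : nat} (f : 'I_n -> 'rV[R]_d -> R)
    (x : 'rV[R]_d) : 'rV[R]_d :=
  n%:R^-1 *: \sum_i grad (f i) x.

Definition prefix_dev {R : realType} {n d : nat} (X : 'I_n -> 'rV[R]_d)
    (s : 'S_n) (i : nat) : 'rV[R]_d :=
  \sum_(j < n | (j < i)%N) X (s j).

Lemma sum_ord_ltS (V : nmodType) n (F : 'I_n -> V) (i : 'I_n) :
  \sum_(j < n | (j < i.+1)%N) F j = \sum_(j < n | (j < i)%N) F j + F i.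
Proof.
rewrite (bigD1 i)//= addrC; congr (_ + _); apply: eq_bigl => j.
by rewrite ltnS [RHS]ltn_neqAle andbC.
Qed.

Lemma sum_ord_ltn (V : nmodType) n (F : 'I_n -> V) :
  \sum_(j < n | (j < n)%N) F j = \sum_(j < n) F j.
Proof. by apply: eq_bigl => j; rewrite ltn_ord. Qed.

Lemma rr_innerS (R : realType) n d (f : 'I_n -> 'rV[R]_d -> R) (a : R)
    (s : 'S_n) (x : 'rV[R]_d) (i : 'I_n) :
  rr_inner f a s x i.+1 =
  rr_inner f a s x i - a *: grad (f (s i)) (rr_inner f a s x i).
Proof.
rewrite /rr_inner (take_nth i) ?size_enum_ord// foldl_rcons.
by rewrite nth_ord_enum.
Qed.

Lemma rr_innerE (R : realType) n d (f : 'I_n -> 'rV[R]_d -> R) (a : R)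
    (s : 'S_n) (x : 'rV[R]_d) (i : nat) : (i <= n)%N ->
  rr_inner f a s x i =
  x - a *: \sum_(j < n | (j < i)%N) grad (f (s j)) (rr_inner f a s x j).
Proof.
elim: i => [|i IH] lein.
  by rewrite big_pred0// scaler0 subr0 /rr_inner take0.
rewrite -[i in RHS]/(nat_of_ord (Ordinal lein)) sum_ord_ltS.
rewrite scalerDr opprD addrA -IH 1?ltnW//.
by rewrite -[i in LHS]/(nat_of_ord (Ordinal lein)) rr_innerS.
Qed.

Lemma sum_const_ord_lt (R : realType) d n (v : 'rV[R]_d) (i : nat) :
  (i <= n)%N -> \sum_(j < n | (j < i)%N) v = i%:R *: v.
Proof.
move=> lein; rewrite -(big_ord_widen n (fun=> v) lein).
by rewrite sumr_const card_ord scaler_nat.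
Qed.

(* With H = (4/3) a (n |G| + M), G the mean gradient at x and M a bound on the
   prefix deviations, |y - x| <= H is preserved along the epoch because
   a L n H <= H / 4. *)
Lemma inner_dist_le (R : realType) n d (f : 'I_n -> 'rV[R]_d -> R) (L a M : R)
    (s : 'S_n) (x : 'rV[R]_d) (i : nat) :
  0 < L -> 0 <= a -> 0 <= M -> a * n%:R * L <= 4^-1 ->
  (forall i, grad_lipschitz L (f i)) ->
  (forall i, (i < n)%N ->
     enorm (prefix_dev (fun j => grad (f j) x - mean_grad f x) s i) <= M) ->
  (i < n)%N ->
  enorm (rr_inner f a s x i - x) <=
    4 / 3 * (a * (n%:R * enorm (mean_grad f x) + M)).
Proof.
move=> L0 a0 M0 aL lip devM; set H := 4 / 3 * _.
have G0 := enorm_ge0 (mean_grad f x).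
have H0 : 0 <= H by rewrite !mulr_ge0// addr_ge0// mulr_ge0.
elim/ltn_ind: i => i IH ltin.
rewrite rr_innerE ?(ltnW ltin)// addrAC subrr sub0r enormN enormZ ger0_norm//.
(* Three contributions: the drift of the iterates away from [x], [i] copies of the mean gradient,
   and the prefix deviation. *)
have -> : \sum_(j < n | (j < i)%N) grad (f (s j)) (rr_inner f a s x j) =
    \sum_(j < n | (j < i)%N) (grad (f (s j)) (rr_inner f a s x j) -
        grad (f (s j)) x) +
    (i%:R *: mean_grad f x +
     prefix_dev (fun j => grad (f j) x - mean_grad f x) s i).
  rewrite -(sum_const_ord_lt _ (ltnW ltin)) -!big_split /=.
  by apply: eq_bigr => j _; rewrite [mean_grad _ _ + _]addrC !subrK.
have h1 : enorm (\sum_(j < n | (j < i)%N)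
    (grad (f (s j)) (rr_inner f a s x j) - grad (f (s j)) x)) <= n%:R * (L * H).
  apply: le_trans (enorm_sum _ _ _) _.
  apply: (@le_trans _ _ (\sum_(j < n) L * H)); last first.
    by rewrite sumr_const card_ord mulr_natl.
  rewrite big_mkcond; apply: ler_sum => j _; case: ifP => ji.
    apply: le_trans (lip _ _ _) _; rewrite ler_pM2l//.
    by apply: IH => //; exact: ltn_trans ltin.
  by rewrite mulr_ge0// ltW.
have h2 : enorm (i%:R *: mean_grad f x +
     prefix_dev (fun j => grad (f j) x - mean_grad f x) s i) <=
     n%:R * enorm (mean_grad f x) + M.
  apply: le_trans (enormD _ _) _; apply: lerD; last exact: devM.
  by rewrite enormZ normr_nat ler_wpM2r// ler_nat ltnW.
apply: (@le_trans _ _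
  (a * (n%:R * (L * H) + (n%:R * enorm (mean_grad f x) + M)))).
  by rewrite ler_wpM2l//; apply: le_trans (enormD _ _) _; exact: lerD.
have -> : a * (n%:R * (L * H) + (n%:R * enorm (mean_grad f x) + M)) =
  a * n%:R * L * H + 3 / 4 * H.
  by rewrite {3}/H; field.
by have := ler_wpM2r H0 aL; lra.
Qed.

(** The vector [g_t] of one epoch, detached from the run: [rr_g] at epoch [t] is convertible to it
    at the iterate [x_t]. *)
Definition epoch_mean {R : realType} {n d : nat} (f : 'I_n -> 'rV[R]_d -> R)
    (a : R) (s : 'S_n) (x : 'rV[R]_d) : 'rV[R]_d :=
  n%:R^-1 *: \sum_(i < n) grad (f (s i)) (rr_inner f a s x i).

(** The mean gradient does not depend on the order, so the difference averages gradient increments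
    of norm at most [L * H], with [H] from [inner_dist_le]. Its two terms are bounded by
    [a n L <= 1/4] and [a L M <= e / 2]. *)
Lemma epoch_mean_dist (R : realType) n d (f : 'I_n -> 'rV[R]_d -> R)
    (L a M e : R) (s : 'S_n) (x : 'rV[R]_d) :
  (0 < n)%N -> 0 < L -> 0 <= a -> 0 <= M -> a * n%:R * L <= 4^-1 ->
  (forall i, grad_lipschitz L (f i)) ->
  (forall i, (i < n)%N ->
     enorm (prefix_dev (fun j => grad (f j) x - mean_grad f x) s i) <= M) ->
  a * L * M <= e / 2 ->
  enorm (epoch_mean f a s x - mean_grad f x) <=
    enorm (mean_grad f x) / 3 + 2 / 3 * e.
Proof.
move=> n0 L0 a0 M0 aL lip devM aLM.
have n0R : 0 < n%:R :> R by rewrite ltr0n.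
have G0 := enorm_ge0 (mean_grad f x).
set H := 4 / 3 * (a * (n%:R * enorm (mean_grad f x) + M)).
have -> : mean_grad f x = n%:R^-1 *: \sum_i grad (f (s i)) x.
  by rewrite /mean_grad (reindex_inj (@perm_inj _ s)).
rewrite -scalerBr -sumrB enormZ ger0_norm ?invr_ge0//.
apply: (@le_trans _ _ (n%:R^-1 * (n%:R * (L * H)))).
  rewrite ler_pM2l ?invr_gt0//.
  apply: le_trans (enorm_sum _ _ _) _.
  apply: (@le_trans _ _ (\sum_(j < n) L * H)); last first.
    by rewrite sumr_const card_ord mulr_natl.
  apply: ler_sum => j _; apply: le_trans (lip _ _ _) _; rewrite ler_pM2l//.
  exact: (inner_dist_le L0).
rewrite (mulrA n%:R^-1) mulVf ?gt_eqF// mul1r.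
have -> : n%:R^-1 *: \sum_i grad (f (s i)) x = mean_grad f x.
  by rewrite /mean_grad [in RHS](reindex_inj (@perm_inj _ s)).
have -> : L * H = 4 / 3 * (a * n%:R * L * enorm (mean_grad f x)) +
   4 / 3 * (a * L * M) by rewrite /H; ring.
by have := ler_wpM2r G0 aL; lra.
Qed.

Lemma favg_descent (R : realType) n d (f : 'I_n -> 'rV[R]_d -> R) (L : R)
    (x v : 'rV[R]_d) :
  (0 < n)%N -> (forall i y, differentiable (f i) y) ->
  (forall i, grad_lipschitz L (f i)) ->
  favg f (x + v) <= favg f x + dot (mean_grad f x) v + L / 2 * dot v v.
Proof.
move=> n0 df lip.
have n0R : 0 < n%:R :> R by rewrite ltr0n.
rewrite -(ler_pM2l n0R) /favg mulrA divff ?gt_eqF// mul1r.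
apply: le_trans (ler_sum _ (fun i _ => descent x v (df i) (lip i))) _.
rewrite !big_split /= sumr_const card_ord -mulr_natl.
rewrite /mean_grad dotZl (dotC (\sum_i _) v) dot_sumr.
under [\sum_i dot v _]eq_bigr do rewrite dotC.
by rewrite !mulrDr !mulrA divff ?gt_eqF// !mul1r -[_ *+ n]mulr_natl !mulrA.
Qed.

Lemma rr_inner_full (R : realType) n d (f : 'I_n -> 'rV[R]_d -> R)
    (a : R) (s : 'S_n) (x : 'rV[R]_d) : (0 < n)%N ->
  rr_inner f a s x n = x - (a * n%:R) *: epoch_mean f a s x.
Proof.
move=> n0; rewrite rr_innerE// sum_ord_ltn /epoch_mean scalerA mulfK//.
by rewrite pnatr_eq0 -lt0n.
Qed.

(** The coefficient 1 of [p ^+ 2] matters: with [p] the norm of the mean gradient, this term cancels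
    once the squared difference is expanded in [epoch_decrease]. *)
Lemma sqr_le_of_le_split (R : realType) (p r e : R) :
  0 <= r -> r <= p / 3 + 2 / 3 * e -> r ^+ 2 <= p ^+ 2 + e ^+ 2 / 2.
Proof.
move=> r0 h; apply: (@le_trans _ _ ((p / 3 + 2 / 3 * e) ^+ 2)).
  by rewrite !expr2 ler_pM.
rewrite -subr_ge0.
have -> : p ^+ 2 + e ^+ 2 / 2 - (p / 3 + 2 / 3 * e) ^+ 2 =
  (4 * p - e) ^+ 2 / 18 by field.
by rewrite divr_ge0// sqr_ge0.
Qed.

(** Here [u] and [w] are the squared norms of [g] and [G], [v] is their inner product and [b = a n].
    The first bound gives [v >= u / 2 - e2 / 4], the smoothness term is at most [b u / 8], and
    [u >= e2] absorbs the rest. *)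
Lemma decrease_arith (R : realType) (b L u v w e2 : R) :
  0 <= b -> b * L <= 4^-1 -> 0 <= u ->
  u - 2 * v + w <= w + e2 / 2 -> e2 <= u ->
  - (b * v) + L / 2 * (b * (b * u)) <= - (b * e2 / 8).
Proof.
move=> b0 bL u0 h1 h2.
have h3 : b * L * (b * u) <= 4^-1 * (b * u) by rewrite ler_wpM2r// mulr_ge0.
have h4 : 0 <= b * (2 * v - u + e2 / 2) by rewrite mulr_ge0//; lra.
have h5 : 0 <= b * (u - e2) by rewrite mulr_ge0//; lra.
lra.
Qed.

Lemma epoch_decrease (R : realType) n d (f : 'I_n -> 'rV[R]_d -> R)
    (L a M e : R) (s : 'S_n) (x : 'rV[R]_d) :
  (0 < n)%N -> 0 < L -> 0 <= a -> 0 <= M -> 0 <= e -> a * n%:R * L <= 4^-1 ->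
  (forall i y, differentiable (f i) y) ->
  (forall i, grad_lipschitz L (f i)) ->
  (forall i, (i < n)%N ->
     enorm (prefix_dev (fun j => grad (f j) x - mean_grad f x) s i) <= M) ->
  a * L * M <= e / 2 -> e < enorm (epoch_mean f a s x) ->
  favg f (rr_inner f a s x n) <= favg f x - a * n%:R * e ^+ 2 / 8.
Proof.
move=> n0 L0 a0 M0 e0 aL df lip devM aLM eg.
have h1 := epoch_mean_dist n0 L0 a0 M0 aL lip devM aLM.
rewrite rr_inner_full//.
set g := epoch_mean f a s x in eg h1 *; set G := mean_grad f x in h1 *.
apply: le_trans (favg_descent _ _ n0 df lip) _.
rewrite -/G dotNr dotNl dotNr !(dotZr (a * _)) (dotZl (a * _)) opprK.
rewrite -!addrA lerD2l; apply: (@decrease_arith _ _ _ _ _ (dot G G)) => //.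
- by rewrite mulr_ge0.
- exact: dot_ge0.
- by have := sqr_le_of_le_split (enorm_ge0 _) h1;
    rewrite !enorm_sqr dot_subr_sqr.
- by rewrite -enorm_sqr !expr2 ler_pM// ltW.
Qed.

(** * Sampling without replacement *)

(** Inversion of [exp (- h) >= 1 - h], as [(1 - h) (1 + h + 2 h^2) = 1 + h^2 (1 - 2 h) >= 1]. *)
Lemma expR_le_quadratic (R : realType) (h : R) :
  h <= 1 / 2 -> expR h <= 1 + h + 2 * h ^+ 2.
Proof.
move=> h2; have h1 : 0 < 1 - h by lra.
have key : 1 <= (1 - h) * (1 + h + 2 * h ^+ 2).
  have : 0 <= h ^+ 2 * (1 - 2 * h) by rewrite mulr_ge0 ?sqr_ge0//; lra.
  by lra.
have q0 : 0 < 1 + h + 2 * h ^+ 2.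
  by rewrite -(pmulr_rgt0 _ h1); apply: lt_le_trans key.
rewrite -[h in expR h]opprK expRN invf_ple ?posrE ?expR_gt0//.
apply: le_trans (expR_ge1Dx _).
by rewrite -div1r ler_pdivrMr.
Qed.

Lemma expR1_le4 (R : realType) : expR 1 <= 4 :> R.
Proof.
have h := @expR_le_quadratic R (1 / 2) (lexx _).
have h2 : expR (1 / 2) <= 2 :> R by apply: le_trans h _; lra.
have -> : expR 1 = expR (1 / 2) * expR (1 / 2) :> R.
  by rewrite -expRD; congr expR; field.
apply: (@le_trans _ _ (2 * 2)); last by lra.
by rewrite ler_pM ?expR_ge0.
Qed.

(* The potential exp (smooth_norm x) dominates exp |x|; its first-order expansion
   (potentialD) has a dimension-free quadratic error. *)
Definition smooth_norm {R : realType} {d : nat} (x : 'rV[R]_d) : R :=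
  Num.sqrt (1 + dot x x).

Lemma smooth_norm_sqr (R : realType) d (x : 'rV[R]_d) :
  smooth_norm x ^+ 2 = 1 + dot x x.
Proof. by rewrite sqr_sqrtr// addr_ge0// dot_ge0. Qed.

Lemma smooth_norm_ge1 (R : realType) d (x : 'rV[R]_d) : 1 <= smooth_norm x.
Proof. by rewrite -[leLHS]sqrtr1 ler_wsqrtr// lerDl dot_ge0. Qed.

Lemma enorm_le_smooth_norm (R : realType) d (x : 'rV[R]_d) :
  enorm x <= smooth_norm x.
Proof. by rewrite enormE ler_wsqrtr// lerDr. Qed.

(** The square root lies below its tangent at [1 + |x|^2]; the proof reads this off the square of
    [smooth_norm (x + y) - smooth_norm x]. *)
Lemma smooth_normD (R : realType) d (x y : 'rV[R]_d) :
  smooth_norm (x + y) <=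
    smooth_norm x + (dot x y + dot y y / 2) / smooth_norm x.
Proof.
have p0 : 0 < smooth_norm x := lt_le_trans ltr01 (smooth_norm_ge1 x).
rewrite -(ler_pM2r p0) mulrDl divfK ?gt_eqF// -expr2 smooth_norm_sqr.
have := sqr_ge0 (smooth_norm (x + y) - smooth_norm x).
rewrite sqrrB !smooth_norm_sqr !(dotDl, dotDr) (dotC y x).
by move: (dot x x) (dot x y) (dot y y) (_ * _) => *; lra.
Qed.

(** Used with [t = <x, y>], [r = |y|] and [f] the smooth norm of [x]. The exponent is at most
    [6 r / 5 <= 12 / 25] in modulus, so [expR_le_quadratic] applies, with error at most
    [(1 / 2 + 72 / 25) r^2]. *)
Lemma potential_arith (R : realType) (f t r : R) :
  1 <= f -> 0 <= r -> r <= 2 / 5 -> `|t| <= f * r ->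
  expR ((t + r ^+ 2 / 2) / f) <= 1 + t / f + 7 / 2 * r ^+ 2.
Proof.
move=> f1 r0 r25 tf; have f0 : 0 < f by lra.
rewrite mulrDl; set a := t / f; set w := r ^+ 2 / 2 / f.
have /andP[a1 a2] : - r <= a <= r.
  by rewrite -ler_norml /a normrM normfV (gtr0_norm f0) ler_pdivrMr// mulrC.
have w0 : 0 <= w by rewrite !divr_ge0 ?sqr_ge0// ltW.
have rr : r ^+ 2 <= 2 / 5 * r by rewrite expr2 ler_wpM2r.
have w1 : w <= r ^+ 2 / 2.
  by rewrite /w ler_pdivrMr// ler_peMr// divr_ge0 ?sqr_ge0.
have h2 : (a + w) ^+ 2 <= (6 / 5 * r) ^+ 2.
  rewrite -[leLHS]real_normK ?num_real// ler_sqr ?nnegrE ?mulr_ge0//.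
  by rewrite ler_norml; apply/andP; split; lra.
apply: le_trans (expR_le_quadratic _) _; first by lra.
by rewrite exprMn in h2; lra.
Qed.

Lemma potentialD (R : realType) d (x y : 'rV[R]_d) : dot y y <= 4 / 25 ->
  expR (smooth_norm (x + y)) <=
  expR (smooth_norm x) * (1 + dot x y / smooth_norm x + 7 / 2 * dot y y).
Proof.
move=> y25.
have r25 : enorm y <= 2 / 5.
  rewrite -ler_sqr ?nnegrE ?enorm_ge0// enorm_sqr.
  by apply: le_trans y25 _; lra.
have tf : `|dot x y| <= smooth_norm x * enorm y.
  apply: (@le_trans _ _ (enorm x * enorm y)); last first.
    by rewrite ler_wpM2r ?enorm_ge0// enorm_le_smooth_norm.
  rewrite ler_norml dot_le_enorm andbT lerNl -dotNr -(enormN y).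
  exact: dot_le_enorm.
have := potential_arith (smooth_norm_ge1 x) (enorm_ge0 y) r25 tf.
rewrite enorm_sqr => h.
apply: le_trans (_ : expR (smooth_norm x +
   (dot x y + dot y y / 2) / smooth_norm x) <= _).
  by rewrite ler_expR smooth_normD.
by rewrite expRD ler_pM2l ?expR_gt0.
Qed.

Lemma prefix_devS (R : realType) n d (X : 'I_n -> 'rV[R]_d) (s : 'S_n)
    (i : 'I_n) : prefix_dev X s i.+1 = prefix_dev X s i + X (s i).
Proof. by rewrite /prefix_dev sum_ord_ltS. Qed.

(** Exchanging positions [i] and [j] realises the draw of [s j] at position [i] and keeps the
    earlier draws. This bijection of permutations takes the place of conditioning on the first [i]
    draws. *)
Lemma prefix_dev_tperm (R : realType) n d (X : 'I_n -> 'rV[R]_d) (s : 'S_n)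
    (i j : 'I_n) : (i <= j)%N ->
  prefix_dev X (tperm i j * s)%g i.+1 = prefix_dev X s i + X (s j).
Proof.
move=> ij; rewrite prefix_devS permM tpermL; congr (_ + _).
apply: eq_bigr => k ki; rewrite permM tpermD//.
  by rewrite neq_ltn ki orbT.
by rewrite neq_ltn (leq_trans ki ij) orbT.
Qed.

Lemma prefix_dev_suffix (R : realType) n d (X : 'I_n -> 'rV[R]_d) (s : 'S_n)
    (i : nat) : \sum_j X j = 0 ->
  \sum_(j < n | (i <= j)%N) X (s j) = - prefix_dev X s i.
Proof.
rewrite (reindex_inj (@perm_inj _ s)) (bigID (fun j : 'I_n => (j < i)%N)) /=.
under [X in _ + X]eq_bigl do rewrite -leqNgt.
by move=> /eqP; rewrite addrC addr_eq0 => /eqP.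
Qed.

Lemma card_ord_ge n i : (i <= n)%N ->
  #|[pred j : 'I_n | (i <= j)%N]| = (n - i)%N.
Proof.
move=> lein; have := card_ord n.
rewrite -[LHS]sum1_card (bigID (fun j : 'I_n => (j < i)%N)) /=.
rewrite -(big_ord_widen n (fun=> 1%N) lein) sum1_card card_ord.
move=> /(congr1 (subn^~ i)); rewrite addKn => <-.
by rewrite -sum1_card; apply: eq_bigl => j; rewrite -leqNgt.
Qed.

(* The drift term is <Z, -Z> <= 0 because the vectors not yet drawn sum to -Z,
   so no centering of the increment is needed. *)
Lemma potential_average (R : realType) n d (X : 'I_n -> 'rV[R]_d) (s : 'S_n)
    (i : 'I_n) : \sum_j X j = 0 -> \sum_j dot (X j) (X j) <= 4 / 25 ->
  \sum_(j < n | (i <= j)%N) expR (smooth_norm (prefix_dev X s i + X (s j))) <=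
  (n - i).+1%:R * expR (smooth_norm (prefix_dev X s i)).
Proof.
move=> X0 XV; set Z := prefix_dev X s i.
have V j : dot (X j) (X j) <= 4 / 25.
  apply: le_trans XV; rewrite (bigD1 j)//= lerDl.
  by apply: sumr_ge0 => k _; exact: dot_ge0.
apply: le_trans (ler_sum _ (fun j _ => potentialD Z (V (s j)))) _.
rewrite -mulr_sumr mulrC ler_pM2r ?expR_gt0//.
rewrite !big_split /= sumr_const card_ord_ge 1?ltnW//.
rewrite -mulr_suml -dot_sumr prefix_dev_suffix// dotNr -mulr_sumr.
have h1 : \sum_(j < n | (i <= j)%N) dot (X (s j)) (X (s j)) <= 4 / 25.
  apply: le_trans XV; rewrite [leRHS](reindex_inj (@perm_inj _ s)) /=.
  rewrite [leRHS](bigID (fun j : 'I_n => (i <= j)%N)) /= lerDl.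
  by apply: sumr_ge0 => k _; exact: dot_ge0.
have h2 : 0 <= dot Z Z / smooth_norm Z by rewrite divr_ge0 ?dot_ge0 ?sqrtr_ge0.
(* The quadratic errors amount to at most [7/2 * 4/25 <= 1], which is the extra unit in
   [(n - i).+1]. *)
by rewrite mulNr -[_.+1]addn1 natrD; lra.
Qed.

(** For each of the [n - i] indices [j >= i], the sum over all orders is reindexed by [tperm i j];
    after exchanging the sums, [potential_average] applies to each order. *)
Lemma potential_step (R : realType) n d (X : 'I_n -> 'rV[R]_d) (i : 'I_n) :
  \sum_j X j = 0 -> \sum_j dot (X j) (X j) <= 4 / 25 ->
  (n - i)%:R * \sum_(s : 'S_n) expR (smooth_norm (prefix_dev X s i.+1)) <=
  (n - i).+1%:R * \sum_(s : 'S_n) expR (smooth_norm (prefix_dev X s i)).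
Proof.
move=> X0 XV.
have -> : (n - i)%:R *
    \sum_(s : 'S_n) expR (smooth_norm (prefix_dev X s i.+1)) =
  \sum_(j < n | (i <= j)%N) \sum_(s : 'S_n)
     expR (smooth_norm (prefix_dev X (tperm i j * s)%g i.+1)).
  rewrite -(card_ord_ge (ltnW (ltn_ord i))) mulr_natl -sumr_const.
  apply: eq_bigr => j _.
  by rewrite (reindex_inj (mulgI (tperm i j))).
rewrite exchange_big mulr_sumr /=; apply: ler_sum => s _.
apply: le_trans (potential_average s i X0 XV).
by apply: ler_sum => j ij; rewrite prefix_dev_tperm.
Qed.

(** By [potential_step] the left-hand side does not increase with [i], and at [i = 0] every order
    has potential [exp 1]. *)
Lemma potential_sum_le (R : realType) n d (X : 'I_n -> 'rV[R]_d) (i : nat) :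
  \sum_j X j = 0 -> \sum_j dot (X j) (X j) <= 4 / 25 -> (i <= n)%N ->
  (n - i).+1%:R * \sum_(s : 'S_n) expR (smooth_norm (prefix_dev X s i)) <=
  n.+1%:R * (n`!%:R * expR 1).
Proof.
move=> X0 XV; elim: i => [|i IH] lein.
  rewrite subn0 ler_pM2l ?ltr0n// le_eqVlt; apply/orP; left; apply/eqP.
  under eq_bigr do
    rewrite /prefix_dev big_pred0// /smooth_norm dot0r addr0 sqrtr1.
  by rewrite sumr_const card_Sn mulr_natl.
apply: le_trans (IH (ltnW lein)).
rewrite subnSK//.
exact: (potential_step (Ordinal lein)).
Qed.

(** Markov's inequality by counting. Since [i < n], the weight [(n - i).+1] is at least 2, which
    with [exp 1 <= 4] leaves the factor [2 (n + 1)]. *)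
Lemma prefix_dev_tail (R : realType) n d (X : 'I_n -> 'rV[R]_d) (i : nat)
    (u : R) :
  \sum_j X j = 0 -> \sum_j dot (X j) (X j) <= 4 / 25 -> (i < n)%N ->
  #|[set s : 'S_n | u < enorm (prefix_dev X s i)]%SET|%:R <=
  n`!%:R * (2 * n.+1%:R) * expR (- u).
Proof.
move=> X0 XV ltin.
have h := potential_sum_le X0 XV (ltnW ltin).
set E := \sum_s _ in h.
have E0 : 0 <= E by apply: sumr_ge0 => s _; exact: expR_ge0.
have hE : E <= n`!%:R * (2 * n.+1%:R).
  have h2 : 2 * E <= (n - i).+1%:R * E.
    by rewrite ler_wpM2r// ler_nat ltnS subn_gt0.
  have h4 : n.+1%:R * (n`!%:R * expR 1) <= n.+1%:R * (n`!%:R * 4) :> R.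
    by rewrite !ler_wpM2l// expR1_le4.
  have := le_trans h2 (le_trans h h4).
  by move: (n.+1%:R : R) (n`!%:R : R) => a b; lra.
rewrite expRN ler_pdivlMr ?expR_gt0//; apply: le_trans hE.
rewrite -sum1_card natr_sum mulr_suml.
rewrite [leRHS](bigID (mem [set s : 'S_n | u < enorm (prefix_dev X s i)]%SET)) /=.
rewrite -[leLHS]addr0; apply: lerD; last first.
  by apply: sumr_ge0 => s _; exact: expR_ge0.
apply: ler_sum => s; rewrite inE => us.
rewrite mul1r ler_expR; apply: le_trans (enorm_le_smooth_norm _).
exact: ltW.
Qed.

(** * Random histories *)

Lemma measurable_fin_fibres dsp (W : measurableType dsp) (T : finType)
    (H : W -> T) (Q : set T) :
  (forall x, measurable [set w | H w = x]) -> measurable [set w | Q (H w)].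
Proof.
move=> mH; have -> : [set w | Q (H w)] = \bigcup_(x in Q) [set w | H w = x].
  by apply/seteqP; split=> w /=; [move=> qw; exists (H w)|move=> [x qx /= ->]].
exact: fin_bigcup_measurable.
Qed.

Lemma fsbig_pred_fintype (R : realType) (T : finType) (Q : pred T)
    (F : T -> \bar R) :
  (\sum_(x \in [set` Q]) F x = \sum_(x in Q) F x)%E.
Proof.
rewrite (fsbigE (enum Q)) ?enum_uniq//.
- rewrite big_enum_cond; apply: eq_bigl => x.
  by rewrite mem_setE andbb.
- by move=> x /=; rewrite mem_enum.
- by move=> x qx; rewrite mem_enum => /negP[].
Qed.

Lemma probability_fin_fibres (R : realType) dsp (W : measurableType dsp)
    (P : probability W R) (T : finType) (H : W -> T) (Q : pred T) :
  (forall x, measurable [set w | H w = x]) ->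
  P [set w | Q (H w)] = (\sum_(x in Q) P [set w | H w = x])%E.
Proof.
move=> mH; have -> : [set w | Q (H w)] =
    \bigcup_(x in [set` Q]) [set w | H w = x].
  by apply/seteqP; split=> w /=; [move=> qw; exists (H w)|move=> [x qx /= ->]].
rewrite measure_fin_bigcup//.
  exact: fsbig_pred_fintype.
by move=> x y _ _ [w [/= <- <-]].
Qed.

Definition history {W : Type} {n : nat} (perms : nat -> W -> 'S_n) (t : nat)
    (w : W) : t.-tuple 'S_n := [tuple perms i w | i < t].

Lemma measurable_history (R : realType) dsp (W : measurableType dsp)
    (P : probability W R) n (perms : nat -> W -> 'S_n) t
    (Q : set (t.-tuple 'S_n)) :
  uniform_reshuffling P perms -> measurable [set w | Q (history perms t w)].
Proof.
move=> [mp _ _]; apply: measurable_fin_fibres => h.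
have -> : [set w | history perms t w = h] =
    \bigcap_(i in [set: 'I_t]) [set w | perms i w = tnth h i].
  apply/seteqP; split=> w /=; first by move=> <- i _ /=; rewrite tnth_mktuple.
  by move=> hw; apply: eq_from_tnth => i; rewrite tnth_mktuple; exact: hw.
exact: fin_bigcap_measurable.
Qed.

Lemma bad_epoch_bigcup (W : Type) n (perms : nat -> W -> 'S_n) t
    (B : t.-tuple 'S_n -> {set 'S_n}) :
  [set w | perms t w \in B (history perms t w)] =
  \bigcup_(h in [set` (predT : pred (t.-tuple 'S_n))])
    ([set w | history perms t w = h] `&` [set w | perms t w \in B h]).
Proof.
apply/seteqP; split=> w /=; last by move=> [h _ [/= -> ]].
by move=> bw; exists (history perms t w).
Qed.

(** The set of bad orders may depend on the past. Splitting by the value [h] of the history makes it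
    constant; independence factors each piece, and the probabilities of the histories sum to at most
    1. *)
Lemma probability_bad_epoch (R : realType) dsp (W : measurableType dsp)
    (P : probability W R) n (perms : nat -> W -> 'S_n) t
    (B : t.-tuple 'S_n -> {set 'S_n}) (p : R) :
  uniform_reshuffling P perms ->
  (forall h, #|B h|%:R <= n`!%:R * p) ->
  (P [set w | perms t w \in B (history perms t w)] <= p%:E)%E.
Proof.
move=> hP hB; have [mp up ip] := hP.
have f0 : 0 < n`!%:R :> R by rewrite ltr0n fact_gt0.
have mh h : measurable [set w | history perms t w = h].
  exact: (measurable_history (fun x => x = h) hP).
have PB h : (P [set w | perms t w \in B h] <= p%:E)%E.
  rewrite probability_fin_fibres; last exact: mp.
  under eq_bigr do rewrite up.
  rewrite sumEFin lee_fin sumr_const -[leLHS]mulr_natl ler_pdivrMr// (mulrC p).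
  exact: hB.
have p0 : 0 <= p.
  by rewrite -(pmulr_rge0 _ f0); apply: le_trans (hB [tuple of nseq t 1%g]).
rewrite bad_epoch_bigcup measure_fin_bigcup//; last 2 first.
- by move=> x y _ _ [w [/= [<- _] [<- _]]].
- move=> h _; apply: measurableI => //.
  exact: (measurable_fin_fibres (fun s => s \in B h) (mp t)).
rewrite fsbig_pred_fintype.
apply: (@le_trans _ _ (\sum_(h : t.-tuple 'S_n) P [set w | history perms t w = h] *
     p%:E)%E).
  apply: lee_sum => h _.
  have := ip t [set h] [set` B h].
  by rewrite /= => ->; exact: lee_wpmul2l.
rewrite -ge0_sume_distrl; last by move=> *; exact: measure_ge0.
rewrite -(@probability_fin_fibres _ _ _ P _ (history perms t) predT)//.
rewrite -[leRHS]mul1e; apply: lee_wpmul2r; first by rewrite lee_fin.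
exact/probability_le1/(measurable_history (fun=> true) hP).
Qed.

Lemma measurable_bad_epoch (R : realType) dsp (W : measurableType dsp)
    (P : probability W R) n (perms : nat -> W -> 'S_n) t
    (B : t.-tuple 'S_n -> {set 'S_n}) :
  uniform_reshuffling P perms ->
  measurable [set w | perms t w \in B (history perms t w)].
Proof.
move=> hP; have [mp _ _] := hP.
rewrite bad_epoch_bigcup; apply: fin_bigcup_measurable => [|h _].
  exact: finite_finset.
apply: measurableI.
  exact: (measurable_history (fun x => x = h) hP).
exact: (measurable_fin_fibres (fun s => s \in B h) (mp t)).
Qed.

Lemma probability_ge_union_bound (R : realType) dsp (W : measurableType dsp)
    (P : probability W R) (E : set W) (bad : nat -> set W) (p : nat -> R)
    (delta : R) T :
  measurable E -> (forall t, measurable (bad t)) ->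
  (forall t, (t < T)%N -> P (bad t) <= (p t)%:E)%E ->
  \sum_(t < T) p t <= delta ->
  (forall w, (forall t, (t < T)%N -> ~ bad t w) -> E w) ->
  ((1 - delta)%:E <= P E)%E.
Proof.
move=> mE mbad Pbad sump hE; set U := \big[setU/set0]_(t < T) bad t.
have mU : measurable U by exact: bigsetU_measurable.
have PU : (P U <= delta%:E)%E.
  apply: le_trans (Boole_inequality _ _) _; first by move=> *; exact: mbad.
  apply: le_trans (_ : \sum_(t < T) (p t)%:E <= _)%E; last first.
    by rewrite sumEFin lee_fin.
  by apply: lee_sum => t _; exact: Pbad.
apply: (@le_trans _ _ (P (~` U))).
  by rewrite probability_setC// EFinB; exact: leeB.
apply: le_measure; rewrite ?inE//; first exact: measurableC.
move=> w nU; apply: hE => t tT bw; apply: nU.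
by rewrite /U -bigcup_mkord; exists t.
Qed.

Definition bad_orders {R : realType} {n d : nat} (X : 'I_n -> 'rV[R]_d)
    (M : R) : {set 'S_n} :=
  [set s : 'S_n | [exists i : 'I_n, M < enorm (prefix_dev X s i)]].

(* Rescaling by 1 / (2 w) makes prefix_dev_tail applicable, as 1 / 12 <= 4 / 25;
   w = 0 (the case F = 0) forces X = 0. *)
Lemma card_bad_orders (R : realType) n d (X : 'I_n -> 'rV[R]_d) (w ell : R) :
  0 <= w -> \sum_j X j = 0 -> \sum_j dot (X j) (X j) <= w ^+ 2 / 3 ->
  #|bad_orders X (4 * w * ell)|%:R <=
  n`!%:R * (2 * n%:R * n.+1%:R * expR (- (2 * ell))).
Proof.
move=> w0 X0 XV.
have [w0'|w0'] := eqVneq w 0; last have {w0' w0}w0 : 0 < w by rewrite lt0r w0'.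
  rewrite w0' expr0n mul0r in XV.
  rewrite w0' mulr0 mul0r (_ : bad_orders X 0 = finset.set0).
    by rewrite cards0 !mulr_ge0// expR_ge0.
  have Xj j : X j = 0.
    apply: dot_eq0; have /psumr_eq0P : forall j, true -> 0 <= dot (X j) (X j).
      by move=> i _; exact: dot_ge0.
    apply=> //; apply/eqP; rewrite eq_le XV.
    by apply: sumr_ge0 => i _; exact: dot_ge0.
  apply/setP => s; rewrite !inE; apply/existsP => -[i].
  by rewrite /prefix_dev big1 ?enorm0 ?ltxx.
pose Y j := (2 * w)^-1 *: X j.
have Y0 : \sum_j Y j = 0 by rewrite -scaler_sumr X0 scaler0.
have YV : \sum_j dot (Y j) (Y j) <= 4 / 25.
  under eq_bigr do rewrite dotZl dotZr mulrA.
  rewrite -mulr_sumr.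
  have h : 0 <= (2 * w)^-1 * (2 * w)^-1 by rewrite -expr2 sqr_ge0.
  apply: le_trans (ler_wpM2l h XV) _.
  have -> : (2 * w)^-1 * (2 * w)^-1 * (w ^+ 2 / 3) = 1 / 12.
    by field; rewrite gt_eqF.
  by lra.
have YX s i : prefix_dev Y s i = (2 * w)^-1 *: prefix_dev X s i.
  by rewrite /prefix_dev scaler_sumr.
(* A union bound over the [n] prefix lengths; after rescaling, the threshold [4 w ell] reads
   [2 ell]. *)
apply: (@le_trans _ _ (\sum_(i < n)
    #|[set s : 'S_n | (2 * ell < enorm (prefix_dev Y s i))%R]%SET|%:R)).
  rewrite -natr_sum ler_nat.
  apply: (@leq_trans #|\big[@finset.setU 'S_n/@finset.set0 'S_n]_(i < n)
      [set s : 'S_n | (2 * ell < enorm (prefix_dev Y s i))%R]%SET|); last first.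
    apply: (big_ind2 (fun (A : {set 'S_n}) m => #|A| <= m)%N) => //.
      by rewrite cards0.
    move=> A a A' a' hA hA'.
    by apply: leq_trans (leq_card_setU _ _) _; exact: leq_add.
  apply: subset_leq_card; apply/fintype.subsetP => s.
  rewrite inE => /existsP[i hi]; apply/finset.bigcupP; exists i => //.
  rewrite inE YX enormZ gtr0_norm ?invr_gt0 ?mulr_gt0//.
  rewrite ltr_pdivlMl ?mulr_gt0//.
  by rewrite (_ : 2 * w * (2 * ell) = 4 * w * ell)//; ring.
apply: le_trans
  (_ : \sum_(i < n) (n`!%:R * (2 * n.+1%:R) * expR (- (2 * ell))) <= _).
  by apply: ler_sum => i _; exact: prefix_dev_tail.
rewrite sumr_const card_ord -mulr_natl le_eqVlt; apply/orP; left; apply/eqP.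
by ring.
Qed.

Lemma sum_grad_dev (R : realType) n d (f : 'I_n -> 'rV[R]_d -> R)
    (x : 'rV[R]_d) : (0 < n)%N ->
  \sum_j (grad (f j) x - mean_grad f x) = 0.
Proof.
move=> n0; rewrite sumrB sumr_const card_ord /mean_grad -scaler_nat scalerA.
by rewrite divff ?scale1r ?subrr// pnatr_eq0 -lt0n.
Qed.

(** Centring does not increase the sum of squares, [sqr_grad_le] bounds each squared gradient by
    [2 L (f_j - fbar_j)], and [favg f x <= favg f x0] bounds the total, which [cstF] is defined to
    express. *)
Lemma sum_sqr_dev_le (R : realType) n d (f : 'I_n -> 'rV[R]_d -> R)
    (L fbar : R) (fbars : 'I_n -> R) (x0 x : 'rV[R]_d) :
  (0 < n)%N -> 0 < L -> (forall i y, differentiable (f i) y) ->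
  (forall i, grad_lipschitz L (f i)) -> (forall i y, fbars i <= f i y) ->
  favg f x <= favg f x0 ->
  \sum_j dot (grad (f j) x - mean_grad f x) (grad (f j) x - mean_grad f x) <=
  n%:R * cstA L * cstF L f fbar fbars x0 / 3.
Proof.
move=> n0 L0 df lip hf hx.
have n0R : 0 < n%:R :> R by rewrite ltr0n.
set G := mean_grad f x.
have sumG : \sum_j grad (f j) x = n%:R *: G.
  by rewrite scalerA divff ?scale1r// gt_eqF.
apply: (@le_trans _ _ (\sum_j dot (grad (f j) x) (grad (f j) x))).
  under eq_bigr do rewrite dot_subr_sqr.
  rewrite big_split sumrB /= -mulr_sumr -dot_sumr sumG dotZr sumr_const card_ord.
  rewrite -[_ *+ n]mulr_natl.
  by have := mulr_ge0 (ltW n0R) (dot_ge0 G); lra.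
apply: (@le_trans _ _ (\sum_j 2 * L * (f j x - fbars j))).
  by apply: ler_sum => j _; exact: sqr_grad_le.
rewrite -mulr_sumr.
have -> : n%:R * cstA L * cstF L f fbar fbars x0 / 3 =
    2 * L * (n%:R * (favg f x0 - fbar) + \sum_i (fbar - fbars i)).
  rewrite /cstF /cstB /cstA; field.
  by rewrite !gt_eqF.
rewrite ler_pM2l ?mulr_gt0// !sumrB sumr_const card_ord -mulr_natl.
have -> : \sum_i f i x = n%:R * favg f x.
  by rewrite mulrA divff ?mul1r// gt_eqF.
have := ler_wpM2l (ltW n0R) hx.
by lra.
Qed.

(** * Step sizes *)

Lemma blockTE k : blockT k = (2 ^ k).-1.
Proof.
elim: k => [|k IH]; first by rewrite /blockT big_ord0.
rewrite /blockT big_ord_recr /= -/(blockT k) IH /blockS expnS mul2n -addnn.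
by case: (2 ^ k)%N (expn_gt0 2 k) => // m _; rewrite addSn.
Qed.

Lemma blockTS k : blockT k.+1 = (blockT k + blockS k)%N.
Proof. by rewrite /blockT big_ord_recr. Qed.

(** As [T_k = 2^k - 1], epoch [t] lies in block [k] exactly when [2^k <= t + 1 < 2^(k+1)]. The
    second bound serves to turn block-dependent probabilities into summable ones in [t]. *)
Lemma block_of_epoch t (k := trunc_log 2 t.+1) :
  (blockT k <= t < blockT k + blockS k)%N /\ (t.+2 <= 2 * blockS k)%N.
Proof.
have /andP[h1 h2] := trunc_log_bounds (isT : 1 < 2)%N (ltn0Sn t).
rewrite -/k in h1 h2; rewrite -blockTS !blockTE /blockS -expnS.
split=> //; apply/andP; split; rewrite -ltnS.
  by rewrite prednK ?expn_gt0.
by rewrite [leqRHS]prednK ?expn_gt0.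
Qed.

Lemma delta_blk_gt0 (R : realType) (delta : R) k :
  0 < delta -> 0 < delta_blk delta k.
Proof.
by move=> d0; apply: divr_gt0; apply: mulr_gt0 => //; rewrite exprn_gt0 ?pi_gt0.
Qed.

Lemma delta_blk_le (R : realType) (delta : R) k :
  0 < delta -> delta_blk delta k <= 3 / 2 * delta.
Proof.
move=> d0; rewrite ler_pdivrMr; last first.
  by apply: mulr_gt0; rewrite exprn_gt0 ?pi_gt0.
have h : 2 ^+ 2 * 1 <= pi ^+ 2 * k.+1%:R ^+ 2 :> R.
  apply: ler_pM => //.
    by rewrite ler_sqr ?nnegrE ?pi_ge0 ?pi_ge2.
  by rewrite -[leLHS](expr1n _ 2) ler_sqr ?nnegrE// ler1n.
have c0 : 0 <= 3 / 2 * delta by rewrite mulr_ge0// ltW.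
apply: le_trans (ler_wpM2l c0 h); rewrite expr2; lra.
Qed.

Lemma ell_blk_arg_gt1 (R : realType) n (delta : R) k :
  (0 < n)%N -> 0 < delta -> delta < 1 ->
  1 < 8 * n%:R * (blockS k)%:R / delta_blk delta k.
Proof.
move=> n0 d0 d1; rewrite ltr_pdivlMr ?delta_blk_gt0// mul1r.
apply: le_lt_trans (delta_blk_le k d0) _.
apply: (@lt_le_trans _ _ (8 * 1 * 1)); first by lra.
rewrite -!mulrA ler_pM2l// ler_pM ?ler1n//.
by rewrite /blockS expn_gt0.
Qed.

Lemma ell_blk_gt0 (R : realType) n (delta : R) k :
  (0 < n)%N -> 0 < delta -> delta < 1 -> 0 < ell_blk n delta k.
Proof. by move=> n0 d0 d1; rewrite ln_gt0// ell_blk_arg_gt1. Qed.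

(** The square in [exp (- 2 ell) = (delta_k / (8 n S_k))^2] pays twice: [n^2] absorbs the [n]
    prefixes and the factor [n + 1], and [4 S_k^2] dominates [(t + 1) (t + 2)]. The constants leave
    [9/16]. *)
Lemma bad_epoch_prob_le (R : realType) n (delta : R) t
    (k := trunc_log 2 t.+1) :
  (0 < n)%N -> 0 < delta -> delta < 1 ->
  2 * n%:R * n.+1%:R * expR (- (2 * ell_blk n delta k)) <=
    delta / (t.+1%:R * t.+2%:R).
Proof.
move=> n0 d0 d1.
have n0R : 0 < n%:R :> R by rewrite ltr0n.
have [_ tS] := block_of_epoch t; rewrite -/k in tS.
have D0 := delta_blk_gt0 k d0; have DL := delta_blk_le k d0.
set D := delta_blk delta k in D0 DL.
set S := (blockS k)%:R : R.
have S0 : 0 < S by rewrite ltr0n expn_gt0.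
have -> : expR (- (2 * ell_blk n delta k)) = (D / (8 * n%:R * S)) ^+ 2.
  rewrite -mulrN expRM_natl expRN /ell_blk lnK.
    by rewrite invf_div.
  by rewrite posrE divr_gt0// !mulr_gt0.
have nn : n.+1%:R <= 2 * n%:R :> R.
  by rewrite -natrM ler_nat mul2n -addnn -addn1 leq_add2l.
apply: (@le_trans _ _ (2 * n%:R * (2 * n%:R) * (D / (8 * n%:R * S)) ^+ 2)).
  by rewrite ler_wpM2r ?sqr_ge0// ler_wpM2l// mulr_ge0// ltW.
have -> : 2 * n%:R * (2 * n%:R) * (D / (8 * n%:R * S)) ^+ 2 =
    D ^+ 2 / (16 * S ^+ 2).
  by field; rewrite !gt_eqF.
have DD : D ^+ 2 <= 9 / 4 * delta.
  apply: (@le_trans _ _ ((3 / 2 * delta) ^+ 2)).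
    by rewrite !expr2; apply: ler_pM => //; exact: ltW.
  have : 0 <= delta * (1 - delta) by rewrite mulr_ge0 ?subr_ge0// ltW.
  by lra.
have TT : t.+1%:R * t.+2%:R <= 4 * S ^+ 2.
  have t2 : t.+2%:R <= 2 * S by rewrite -natrM ler_nat.
  have t1 : t.+1%:R <= 2 * S by apply: le_trans t2; rewrite ler_nat.
  have -> : 4 * S ^+ 2 = 2 * S * (2 * S) by ring.
  exact: ler_pM.
rewrite ler_pdivlMr ?mulr_gt0// mulrAC ler_pdivrMr ?mulr_gt0 ?exprn_gt0//.
apply: (@le_trans _ _ (9 / 4 * delta * (4 * S ^+ 2))).
  by apply: ler_pM => //; rewrite ?sqr_ge0 ?mulr_ge0.
have : 0 <= delta * S ^+ 2 by rewrite mulr_ge0 ?sqr_ge0 ?ltW.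
by lra.
Qed.

Lemma sum_telescope_inv (R : realType) T :
  \sum_(t < T) (t.+1%:R * t.+2%:R)^-1 <= 1 :> R.
Proof.
suff -> : \sum_(t < T) (t.+1%:R * t.+2%:R)^-1 = 1 - T.+1%:R^-1 :> R.
  by rewrite gerBl invr_ge0.
elim: T => [|T IH]; first by rewrite big_ord0 invr1 subrr.
rewrite big_ord_recr /= IH -[T.+2%:R]natr1.
have T0 : (T.+1%:R : R) != 0 by rewrite pnatr_eq0.
have T1 : (T.+1%:R + 1 : R) != 0 by rewrite natr1 pnatr_eq0.
by move: T0 T1; move: (T.+1%:R : R) => a a0 a1; field; rewrite a0 a1.
Qed.

Lemma alpha_sc_gt0 (R : realType) n (L F eta eps delta : R) k :
  (0 < n)%N -> 0 < L -> 0 <= F -> 0 < eta * eps -> 0 < delta -> delta < 1 ->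
  0 < alpha_sc n L F eta eps delta k.
Proof.
move=> n0 L0 F0 e0 d0 d1.
have n0R : 0 < n%:R :> R by rewrite ltr0n.
have h : 0 < (4 * n%:R * L)^-1 by rewrite invr_gt0 !mulr_gt0.
rewrite /alpha_sc; case: eqVneq => // F1.
have s0 : 0 < Num.sqrt (n%:R * cstA L * F).
  by rewrite sqrtr_gt0 !mulr_gt0// lt0r F1.
rewrite lt_min h /=; apply: divr_gt0 => //.
by rewrite mulr_gt0 ?ell_blk_gt0// !mulr_gt0.
Qed.

Lemma alpha_sc_le (R : realType) n (L F eta eps delta : R) k :
  (0 < n)%N -> 0 < L -> alpha_sc n L F eta eps delta k * n%:R * L <= 4^-1.
Proof.
move=> n0 L0; have n0R : 0 < n%:R :> R by rewrite ltr0n.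
rewrite -mulrA -ler_pdivlMr ?mulr_gt0//.
have -> : 4^-1 / (n%:R * L) = (4 * n%:R * L)^-1.
  by rewrite -mulrA [in RHS]invfM.
by rewrite /alpha_sc; case: (F == 0); rewrite ?ge_min lexx.
Qed.

(** This is what the second term of the minimum is tuned for: it turns the threshold [4 w ell] of
    [card_bad_orders] into [eta eps / 2]. For [F = 0] the threshold vanishes. *)
Lemma alpha_sc_dev (R : realType) n (L F eta eps delta : R) k :
  (0 < n)%N -> 0 < L -> 0 <= F -> 0 < eta * eps -> 0 < delta -> delta < 1 ->
  alpha_sc n L F eta eps delta k * L *
    (4 * Num.sqrt (n%:R * cstA L * F) * ell_blk n delta k) <= eta * eps / 2.
Proof.
move=> n0 L0 F0 e0 d0 d1; have n0R : 0 < n%:R :> R by rewrite ltr0n.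
have l0 := ell_blk_gt0 k n0 d0 d1; set l := ell_blk _ _ _ in l0 *.
rewrite /alpha_sc -/l; case: eqVneq => [->|F1].
  by rewrite mulr0 sqrtr0 !(mulr0, mul0r) ltW// divr_gt0.
have s0 : 0 < Num.sqrt (n%:R * cstA L * F).
  by rewrite sqrtr_gt0 !mulr_gt0// lt0r F1.
set s := Num.sqrt _ in s0 *.
have -> : eta * eps / 2 = eta * eps / (8 * s * L * l) * (L * (4 * s * l)).
  by field; rewrite !gt_eqF.
by rewrite -mulrA ler_wpM2r ?ge_min ?lexx ?orbT// !mulr_ge0// ltW.
Qed.

(** * Choice of the final block *)

Lemma leq_sqrS_exp2 k : (k.+1 ^ 2 <= 4 * 2 ^ k)%N.
Proof.
elim: k => // k IH; case: k IH => [|[|k]] // IH.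
rewrite [(2 ^ k.+3)%N]expnS mulnCA; apply: leq_trans (leq_mul (leqnn 2) IH).
rewrite -(leq_add2r (k.+3 ^ 2)) mul2n -addnn -!mulnn.
nia.
Qed.

(** The least [k] with [(k + 1) y < 2^k] is taken; its predecessor fails, whence the upper bound.
    The factor [k + 1] is there to absorb the growth of [ell_k], at most linear by [ell_blk_le]. *)
Lemma exists_block (R : realType) (y : R) : 1 <= y ->
  exists k : nat, k.+1%:R * y < 2 ^+ k /\ 2 ^+ k <= 2 * (k.+1%:R * y).
Proof.
move=> y1.
have ex : exists k : nat, k.+1%:R * y < 2 ^+ k.
  (* With [2 y < 2^m], the index [2 m] works since [2 m + 1 <= 2 * 2^m]. *)
  pose m := Num.bound (2 * y); exists (m + m)%N.
  have hm : 2 * y < 2 ^+ m.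
    apply: (@lt_le_trans _ _ m%:R); first by rewrite archi_boundP//; lra.
    by rewrite -natrX ler_nat ltnW// ltn_expl.
  have mm : (m + m).+1%:R <= 2 * 2 ^+ m :> R.
    by rewrite -natrX -natrM ler_nat; have := ltn_expl m (isT : 1 < 2)%N; lia.
  rewrite exprD; apply: (@le_lt_trans _ _ (2 ^+ m * (2 * y))).
    by rewrite mulrA ler_pM2r ?(mulrC _ 2)//; lra.
  by rewrite ltr_pM2l// exprn_gt0.
case: (ex_minnP ex) => -[|k] hk kmin.
  by exfalso; move: hk; rewrite expr0 mul1r; lra.
exists k.+1; split=> //; rewrite exprS ler_pM2l//.
have : 2 ^+ k <= k.+1%:R * y.
  by rewrite leNgt; apply/negP => /kmin; rewrite ltnn.
move=> /le_trans; apply; rewrite ler_pM2r ?ler_nat//; lra.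
Qed.

Lemma ln2_ge (R : realType) : 1 / 2 <= ln 2 :> R.
Proof.
rewrite -ler_expR lnK ?posrE//.
by apply: le_trans (expR_le_quadratic (lexx _)) _; lra.
Qed.

(* Squaring the hypothesis and using (k + 1)^2 <= 4 2^k gives 2^k = O((c l x)^2),
   so k is logarithmic in x. *)
Lemma block_index_le (R : realType) (c l x : R) k :
  1 <= c -> 1 <= l -> 1 <= x -> ln x <= 3 * l ->
  2 ^+ k <= 2 * (k.+1%:R * (c * l * x)) -> k.+1%:R <= 53 * c * l.
Proof.
move=> c1 l1 x1 lx hk.
have [c0 l0 x0] : [/\ 0 < c, 0 < l & 0 < x] by split; lra.
set y := c * l * x in hk; have y0 : 0 < y by rewrite !mulr_gt0.
have p0 : 0 < 2 ^+ k :> R by rewrite exprn_gt0.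
have key : 2 ^+ k <= 16 * y ^+ 2.
  rewrite -(ler_pM2l p0).
  apply: (@le_trans _ _ ((2 * (k.+1%:R * y)) ^+ 2)).
    by rewrite [leRHS]expr2; apply: ler_pM => //; exact: ltW.
  have : k.+1%:R ^+ 2 <= 4 * 2 ^+ k :> R.
    by rewrite -!natrX -natrM ler_nat leq_sqrS_exp2.
  move=> /(ler_wpM2r (sqr_ge0 y)) h.
  have -> : (2 * (k.+1%:R * y)) ^+ 2 = 4 * (k.+1%:R ^+ 2 * y ^+ 2) by ring.
  lra.
have hln : k%:R * ln 2 <= ln 16 + 2 * (ln c + ln l + ln x).
  have -> : k%:R * ln 2 = ln (2 ^+ k) :> R by rewrite lnXn// mulr_natl.
  have -> : ln 16 + 2 * (ln c + ln l + ln x) = ln (16 * y ^+ 2).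
    rewrite lnM ?posrE ?exprn_gt0// lnXn// /y !lnM ?posrE ?mulr_gt0//.
    by rewrite mulr_natl.
  by rewrite ler_ln ?posrE ?mulr_gt0 ?exprn_gt0.
(* The logarithms of 16, [c] and [l] are bounded by their arguments, that of [x] by [3 l]; hence
   [33 + 4 c + 16 l], and [33 + 4 + 16 = 53]. *)
have h16 : ln 16 < 16 :> R by rewrite ln_sublinear.
have hc := ln_sublinear c0; have hl := ln_sublinear l0.
have h2 : k%:R * (1 / 2) <= k%:R * ln 2 :> R by rewrite ler_wpM2l// ln2_ge.
have kl : k.+1%:R <= 33 + 4 * c + 16 * l by rewrite -[k.+1%:R]natr1; lra.
have cl1 : 0 <= (c - 1) * (l - 1) by rewrite mulr_ge0; lra.
lra.
Qed.

(** Inside the logarithm, [S_k] contributes [k ln 2] and [delta_k] contributes [2 ln (k + 1)], so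
    the growth in [k] is at most linear; [pi <= 4] bounds the constant term by 22. The term [u]
    leaves room for the logarithm of the accuracy. *)
Lemma ell_blk_le (R : realType) n (delta u : R) k :
  (0 < n)%N -> 0 < delta -> delta < 1 -> 0 <= u ->
  ell_blk n delta k <= 30 * (k.+1%:R * (1 + ln n%:R + ln delta^-1 + u)).
Proof.
move=> n0 d0 d1 u0.
have n0R : 0 < n%:R :> R by rewrite ltr0n.
have k0 : 0 < k.+1%:R :> R by rewrite ltr0n.
have p0 : 0 < pi :> R := pi_gt0 R.
have c0 : 0 < 8 * pi ^+ 2 / 6 :> R by rewrite divr_gt0// mulr_gt0// exprn_gt0.
have -> : ell_blk n delta k =
    ln (8 * pi ^+ 2 / 6) + ln n%:R + k%:R * ln 2 + 2 * ln k.+1%:R + ln delta^-1.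
  rewrite /ell_blk.
  have -> : 8 * n%:R * (blockS k)%:R / delta_blk delta k =
     8 * pi ^+ 2 / 6 * n%:R * 2 ^+ k * k.+1%:R ^+ 2 * delta^-1.
    rewrite /blockS natrX /delta_blk.
    move: (pi : R) p0 (k.+1%:R : R) k0 (n%:R : R) => p p0 q q0 m; field.
    by rewrite !gt_eqF.
  rewrite !lnM ?posrE ?invr_gt0 ?mulr_gt0 ?exprn_gt0//.
  by rewrite !lnXn// !mulr_natl.
have hc : ln (8 * pi ^+ 2 / 6) <= 22 :> R.
  apply: le_trans (ltW (ln_sublinear c0)) _.
  have /andP[_ h2] := (@pihalf_02_cos_pihalf R).1.
  have p4 : pi <= 4 :> R by lra.
  have : pi ^+ 2 <= 4 ^+ 2 :> R by rewrite ler_sqr ?nnegrE// ltW.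
  lra.
have ln0 : 0 <= ln n%:R :> R by rewrite ln_ge0// ler1n.
have ld0 : 0 <= ln delta^-1 :> R by rewrite ln_ge0// invf_ge1// ltW.
have l2 : k%:R * ln 2 <= k%:R * 2 :> R by rewrite ler_wpM2l// ltW// ln_sublinear.
have lk := ln_sublinear k0.
have k1 : 1 <= k.+1%:R :> R by rewrite ler1n.
have kk : k%:R = k.+1%:R - 1 :> R by rewrite -natr1 addrK.
rewrite kk in l2 *.
move: lk k1 l2; set q := k.+1%:R : R => lk k1 l2.
set v := ln n%:R + ln delta^-1.
have v0 : 0 <= v by exact: addr_ge0.
have : 0 <= (q - 1) * (v + u) by rewrite mulr_ge0 ?subr_ge0 ?addr_ge0.
have -> : 1 + ln n%:R + ln delta^-1 + u = 1 + (v + u) by rewrite /v; ring.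
have : ln n%:R + ln delta^-1 = v by [].
lra.
Qed.

(** * The whole run *)

(** The two terms of the minimum are treated separately: [32 L D] in [c] serves the first and
    [30 (64 D L sqrt (A F))] the second, where [30 (k + 1) l] majorises [ell_k]. In the application,
    [x] is the maximum in the complexity divided by [n]. *)
Lemma block_progress (R : realType) n (L F D eta eps delta c l x : R) k
    (e := eta * eps) :
  (0 < n)%N -> 0 < L -> 0 <= F -> 0 <= D -> 0 < e -> 0 < delta -> delta < 1 ->
  1 + 32 * L * D + 30 * (64 * D * L * Num.sqrt (cstA L * F)) <= c ->
  ell_blk n delta k <= 30 * (k.+1%:R * l) -> 1 <= l ->
  e ^- 2 <= x -> Num.sqrt n%:R * e ^- 3 <= n%:R * x ->
  k.+1%:R * (c * l * x) < 2 ^+ k ->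
  D < 2 ^+ k * (alpha_sc n L F eta eps delta k * n%:R * e ^+ 2 / 8).
Proof.
move=> n0 L0 F0 D0 e0 d0 d1 hc hell l1 x2 x3 hk.
have n0R : 0 < n%:R :> R by rewrite ltr0n.
have q1 : 1 <= k.+1%:R :> R by rewrite ler1n.
have e20 : 0 < e ^+ 2 by rewrite exprn_gt0.
have e30 : 0 < e ^+ 3 by rewrite exprn_gt0.
set s := Num.sqrt (cstA L * F) in hc.
have s0 : 0 <= s := sqrtr_ge0 _.
have c1 : 0 <= 32 * L * D by rewrite !mulr_ge0// ltW.
have c2 : 0 <= 64 * D * L * s by rewrite !mulr_ge0// ltW.
have ge1 : 1 <= e ^+ 2 * x by rewrite -ler_pdivrMl// mulr1.
have ql : 1 <= k.+1%:R * l by rewrite -[leLHS]mulr1 ler_pM.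
(* Serves both [F = 0] and the case where the first term attains the minimum. *)
have first : D < 2 ^+ k * ((4 * n%:R * L)^-1 * n%:R * e ^+ 2 / 8).
  have -> : 2 ^+ k * ((4 * n%:R * L)^-1 * n%:R * e ^+ 2 / 8) =
    2 ^+ k * e ^+ 2 / (32 * L).
    by field; rewrite !gt_eqF.
  rewrite ltr_pdivlMr ?mulr_gt0//.
  apply: (@le_lt_trans _ _ (k.+1%:R * (c * l * x) * e ^+ 2)); last first.
    by rewrite ltr_pM2r.
  have -> : k.+1%:R * (c * l * x) * e ^+ 2 = (k.+1%:R * l) * (e ^+ 2 * x) * c
    by ring.
  apply: (@le_trans _ _ (1 * c)); first by lra.
  rewrite ler_pM2r; last by lra.
  by rewrite -[leLHS]mulr1 ler_pM.
rewrite /alpha_sc; case: eqVneq => // F1.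
rewrite /Num.min /Order.min; case: ifP => // _.
have l0 := ell_blk_gt0 k n0 d0 d1; set ell := ell_blk _ _ _ in hell l0 *.
have s1 : 0 < s by rewrite sqrtr_gt0 !mulr_gt0// lt0r F1.
set r := Num.sqrt n%:R in x3 *.
have r0 : 0 < r by rewrite sqrtr_gt0.
have rr : r ^+ 2 = n%:R by rewrite sqr_sqrtr// ltW.
have -> : Num.sqrt (n%:R * cstA L * F) = r * s by rewrite -mulrA sqrtrM// ltW.
have -> : 2 ^+ k * (eta * eps / (8 * (r * s) * L * ell) * n%:R * e ^+ 2 / 8) =
   2 ^+ k * (r * e ^+ 3) / (64 * s * L * ell).
  rewrite -/e -rr; field.
  by rewrite !gt_eqF.
rewrite ltr_pdivlMr ?mulr_gt0//.
have x3' : 1 <= r * e ^+ 3 * x.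
  rewrite -(ler_pM2l r0) mulr1.
  have -> : r * (r * e ^+ 3 * x) = e ^+ 3 * (n%:R * x) by rewrite -rr; ring.
  by rewrite -ler_pdivrMl// mulrC.
apply: (@le_lt_trans _ _ (k.+1%:R * (c * l * x) * (r * e ^+ 3))); last first.
  by rewrite ltr_pM2r// mulr_gt0.
have -> : k.+1%:R * (c * l * x) * (r * e ^+ 3) =
  (k.+1%:R * l * c) * (r * e ^+ 3 * x) by ring.
apply: (@le_trans _ _ (k.+1%:R * l * c * 1)); last first.
  by rewrite ler_pM2l// !mulr_gt0//; lra.
apply: (@le_trans _ _ (30 * (k.+1%:R * l) * (64 * D * L * s))).
  have -> : D * (64 * s * L * ell) = ell * (64 * D * L * s) by ring.
  by rewrite ler_wpM2r// !mulr_ge0// ltW.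
have -> : 30 * (k.+1%:R * l) * (64 * D * L * s) =
  k.+1%:R * l * (30 * (64 * D * L * s)) by ring.
by rewrite mulr1 ler_pM2l; lra.
Qed.

(** A deterministic argument by contradiction. The induction keeps [favg f (x t) <= favg f x0], so
    the deviation bound is asked only at such iterates; without a stop, the accumulated decrease
    would push [favg f] below [fbar]. *)
Lemma run_stops (R : realType) n d (f : 'I_n -> 'rV[R]_d -> R) (L fbar e : R)
    (alpha : nat -> R) (s : nat -> 'S_n) (x0 : 'rV[R]_d) T
    (x := rr_iter f alpha s x0) :
  (0 < n)%N -> 0 < L -> 0 <= e -> (forall i y, differentiable (f i) y) ->
  (forall i, grad_lipschitz L (f i)) -> (forall y, fbar <= favg f y) ->
  (forall t, 0 < alpha t) -> (forall t, alpha t * n%:R * L <= 4^-1) ->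
  (forall t, (t < T)%N -> favg f (x t) <= favg f x0 ->
     forall i, (i < n)%N -> alpha t * L * enorm (prefix_dev
       (fun j => grad (f j) (x t) - mean_grad f (x t)) (s t) i) <= e / 2) ->
  favg f x0 - fbar < \sum_(t < T) alpha t * n%:R * e ^+ 2 / 8 ->
  exists2 t, (t < T)%N & enorm (rr_g f alpha s x0 t) <= e.
Proof.
move=> n0 L0 e0 df lip hfbar a0 aL good budget; apply: contrapT => nstop.
have big_g t : (t < T)%N -> e < enorm (rr_g f alpha s x0 t).
  by move=> tT; rewrite ltNge; apply/negP => ht; apply: nstop; exists t.
have key t : (t <= T)%N ->
    favg f (x t) <= favg f x0 - \sum_(u < t) alpha u * n%:R * e ^+ 2 / 8.
  elim: t => [|t IH] tT; first by rewrite big_ord0 subr0.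
  have {}IH := IH (ltnW tT).
  have dec : 0 <= \sum_(u < t) alpha u * n%:R * e ^+ 2 / 8.
    by apply: sumr_ge0 => u _; rewrite !mulr_ge0 ?sqr_ge0//; exact: ltW.
  have xt : favg f (x t) <= favg f x0 by apply: le_trans IH _; rewrite gerBl.
  have aL0 : 0 < alpha t * L by rewrite mulr_gt0.
  rewrite big_ord_recr /= opprD addrA; apply: le_trans (lerB IH (lexx _)).
  apply: (@epoch_decrease _ _ _ _ L _ ((alpha t * L)^-1 * (e / 2))) => //.
  - exact: ltW.
  - by rewrite mulr_ge0 ?divr_ge0// invr_ge0 ltW.
  - by move=> i iltn; rewrite ler_pdivlMl//; exact: good.
  - by rewrite mulrA divff ?mul1r// gt_eqF.
  - exact: big_g.
by have := key T (leqnn T); have := hfbar (x T); lra.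
Qed.

(** If some epoch stops, the infimum is attained at the first one; otherwise it is [+oo], and
    [0 < n] keeps the product [+oo], whereas [0 * +oo = 0]. *)
Lemma rr_tau_le (R : realType) n d (f : 'I_n -> 'rV[R]_d -> R)
    (alpha : nat -> R) (s : nat -> 'S_n) (x0 : 'rV[R]_d) (tol c : R) :
  (0 < n)%N ->
  (n%:R%:E * rr_tau f alpha s x0 tol <= c%:E)%E <->
  exists t : nat, n%:R * t%:R <= c /\ enorm (rr_g f alpha s x0 t) <= tol.
Proof.
move=> n0; have n0R : 0 < n%:R :> R by rewrite ltr0n.
have [ex|nex] := pselect (exists t, enorm (rr_g f alpha s x0 t) <= tol).
  case: (ex_minnP ex) => m hm mmin.
  have -> : rr_tau f alpha s x0 tol = m%:R%:E.
    apply/eqP; rewrite eq_le; apply/andP; split.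
      by apply: ereal_inf_lbound; exists m.
    by apply: le_ereal_inf_tmp => _ [t ht <-]; rewrite lee_fin ler_nat mmin.
  rewrite -EFinM lee_fin; split=> [h|[t [ht gt]]]; first by exists m.
  by apply: le_trans ht; rewrite ler_pM2l// ler_nat mmin.
have -> : rr_tau f alpha s x0 tol = +oo%E.
  rewrite /rr_tau (_ : [set t | _] = set0) ?image_set0 ?ereal_inf0//.
  by apply/seteqP; split=> t //= ht; apply: nex; exists t.
rewrite gt0_muley ?lte_fin//; split=> [|[t [_ ht]]]; first by rewrite leye_eq.
by case: nex; exists t.
Qed.

(** Adaptedness of the iterates: it makes the bad orders of epoch [t] a function of the history, as
    [probability_bad_epoch] requires. *)
Lemma rr_iter_ext (R : realType) n d (f : 'I_n -> 'rV[R]_d -> R)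
    (alpha : nat -> R) (s s' : nat -> 'S_n) (x0 : 'rV[R]_d) t :
  (forall i, (i < t)%N -> s i = s' i) ->
  rr_iter f alpha s x0 t = rr_iter f alpha s' x0 t.
Proof.
elim: t => [//|t IH] ss'.
have {}IH := IH (fun i it => ss' i (ltnW it)).
by rewrite /= IH (ss' t (ltnSn t)).
Qed.

Lemma nth_history (W : Type) n (perms : nat -> W -> 'S_n) t w i :
  (i < t)%N -> nth 1%g (history perms t w) i = perms i w.
Proof.
by move=> it; rewrite -[i]/(nat_of_ord (Ordinal it)) -tnth_nth tnth_mktuple.
Qed.

Lemma measurable_tau_le (R : realType) n d (f : 'I_n -> 'rV[R]_d -> R)
    (alpha : nat -> R) dsp (W : measurableType dsp) (P : probability W R)
    (perms : nat -> W -> 'S_n) (x0 : 'rV[R]_d) (tol c : R) :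
  (0 < n)%N -> uniform_reshuffling P perms ->
  measurable [set w |
    (n%:R%:E * rr_tau f alpha (perms^~ w) x0 tol <= c%:E)%E].
Proof.
move=> n0 hP.
(* Deciding whether epoch [t] stops takes [t + 1] orders; the default of [nth] is never read. *)
pose Q t := [set h : t.+1.-tuple 'S_n | n%:R * t%:R <= c /\
  enorm (rr_g f alpha (nth 1%g h) x0 t) <= tol].
rewrite (_ : [set w | _] = \bigcup_t [set w | Q t (history perms t.+1 w)]).
  apply: bigcup_measurable => t _.
  exact: (measurable_history (Q t) hP).
have gE t w : rr_g f alpha (nth 1%g (history perms t.+1 w)) x0 t =
    rr_g f alpha (perms^~ w) x0 t.
  have xE : rr_iter f alpha (nth 1%g (history perms t.+1 w)) x0 t =
      rr_iter f alpha (perms^~ w) x0 t.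
    by apply: rr_iter_ext => i it; apply: nth_history; exact: ltnW.
  by rewrite /rr_g xE (nth_history perms w (ltnSn t)).
apply/seteqP; split=> w /=.
  move=> /(rr_tau_le f alpha (perms^~ w) x0 tol c n0)[t [h1 h2]].
  have hQ : Q t (history perms t.+1 w) 
    by split; [exact: h1|rewrite gE; exact: h2].
  exact: (ex_intro2 _ _ t I hQ).
move=> [t _ [h1 h2]]; rewrite gE in h2.
exact/(rr_tau_le f alpha (perms^~ w) x0 tol c n0)/(ex_intro _ t (conj h1 h2)).
Qed.

Lemma block_sum_ge (R : realType) (alpha : nat -> R) (a b : R) k :
  0 <= b -> (forall t, 0 < alpha t) ->
  (forall t, (blockT k <= t < blockT k + blockS k)%N -> alpha t = a) ->
  2 ^+ k * (a * b) <= \sum_(t < blockT k.+1) alpha t * b.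
Proof.
move=> b0 a0 ha; rewrite blockTS big_split_ord /= -[leLHS]add0r; apply: lerD.
  by apply: sumr_ge0 => t _; rewrite mulr_ge0// ltW.
rewrite -natrX mulr_natl -[X in _ *+ X]card_ord -sumr_const; apply: ler_sum => t _.
by rewrite ha// leq_addr ltn_add2l ltn_ord.
Qed.

(** Since [sqrt n <= n] and [e <= 1], the maximum is at most [n e^(-3)], which gives the logarithmic
    bound; its entry [n e^(-2)] gives the first and third bounds. *)
Lemma maxr_scale_bounds (R : realType) n (e : R)
    (mx := Num.max (Num.sqrt n%:R * e ^- 3) (n%:R * e ^- 2)) :
  (0 < n)%N -> 0 < e -> e <= 1 ->
  [/\ e ^- 2 <= n%:R^-1 * mx, Num.sqrt n%:R * e ^- 3 <= mx,
      1 <= n%:R^-1 * mx & ln (n%:R^-1 * mx) <= 3 * ln e^-1].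
Proof.
move=> n0 e0 e1; have n0R : 0 < n%:R :> R by rewrite ltr0n.
have n1 : 1 <= n%:R :> R by rewrite ler1n.
have h2 : e ^- 2 <= n%:R^-1 * mx by rewrite ler_pdivlMl// le_max lexx orbT.
have h1 : 1 <= n%:R^-1 * mx.
  by apply: le_trans h2; rewrite invf_ge1 ?exprn_gt0// exprn_ile1// ltW.
split=> //; first by rewrite le_max lexx.
have -> : 3 * ln e^-1 = ln (e ^- 3).
  by rewrite -exprVn lnXn ?invr_gt0// mulr_natl.
rewrite ler_ln ?posrE ?invr_gt0 ?exprn_gt0 ?(lt_le_trans ltr01 h1)//.
rewrite ler_pdivrMl// ge_max; apply/andP; split.
  rewrite ler_wpM2r ?invr_ge0 ?exprn_ge0 ?(ltW e0)//.
  rewrite -ler_sqr ?nnegrE ?sqrtr_ge0 ?(ltW n0R)// sqr_sqrtr ?(ltW n0R)//.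
  by rewrite expr2 ler_peMr// ltW.
rewrite ler_pM2l// lef_pV2 ?posrE ?exprn_gt0//.
by rewrite [e ^+ 3]exprS ler_piMl// exprn_ge0// ltW.
Qed.

Theorem theorem4p3 :
  exists p : nat, forall R : realType, exists C : R -> R -> R -> R,
  forall (n d : nat) (f : 'I_n -> 'rV[R]_d -> R) (L fbar : R)
    (fbars : 'I_n -> R) (x0 : 'rV[R]_d) (eta eps delta : R) (alpha : nat -> R)
    (dsp : measure_display) (W : measurableType dsp) (P : probability W R)
    (perms : nat -> W -> 'S_n),
  let B := cstB L fbar fbars in
  let F := cstF L f fbar fbars x0 in
  (0 < n)%N ->
  0 < L ->
  (forall i, cont_differentiable (f i)) ->
  (forall i, grad_lipschitz L (f i)) ->
  (forall i x, fbars i <= f i x) ->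
  (forall x, fbar <= favg f x) ->
  0 <= B ->
  0 < eta -> 0 < eps -> eta * eps <= 1 ->
  0 < delta -> delta < 1 ->
  (forall k t, (blockT k <= t < blockT k + blockS k)%N ->
     alpha t = alpha_sc n L F eta eps delta k) ->
  uniform_reshuffling P perms ->
  ((1 - delta)%:E <=
   P [set w |
     (n%:R%:E * rr_tau f alpha (fun t => perms t w) x0 (eta * eps) <=
      (C L (favg f x0 - fbar) B *
       Num.max (Num.sqrt n%:R * (eta * eps) ^- 3) (n%:R * (eta * eps) ^- 2) *
       (1 + ln n%:R + ln (delta^-1) + ln ((eta * eps)^-1)) ^+ p)%:E)%E])%E.

Proof.
(* Two logarithmic factors occur: [l] in the target [c l x] given to [exists_block], and another in
   [k + 1 <= 53 c l]. *)
exists 2%N => R.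
(* The constant required by [block_progress], with [F] rewritten through [L], [D] and [B]. *)
pose c (L D B : R) : R := 1 + 32 * L * D +
  30 * (64 * D * L * Num.sqrt (cstA L * (3 * D + 3 * B / cstA L))).
(* [212 = 2 * 2 * 53]: a factor 2 from [T_(k+1) <= 2 * 2^k], another from [exists_block], and 53
   from [block_index_le]. *)
exists (fun L D B => 212 * c L D B ^+ 2).
move=> n d f L fbar fbars x0 eta eps delta alpha dsp W P perms B F.
move=> n0 L0 cdf lip hf hfbar B0 eta0 eps0 e1 d0 d1 halpha hP.
set D := favg f x0 - fbar.
have D0 : 0 <= D by rewrite subr_ge0.
have A0 : 0 < cstA L by rewrite mulr_gt0.
have F0 : 0 <= F.
  apply: addr_ge0; first exact: mulr_ge0.
  by apply: divr_ge0; [exact: mulr_ge0|exact: ltW].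
have e0 : 0 < eta * eps by rewrite mulr_gt0.
have n0R : 0 < n%:R :> R by rewrite ltr0n.
have df i y : differentiable (f i) y := (cdf i).1 y.
set u := ln (eta * eps)^-1.
have u0 : 0 <= u by rewrite ln_ge0// invf_ge1.
have ln0 : 0 <= ln n%:R :> R by rewrite ln_ge0// ler1n.
have ld0 : 0 <= ln delta^-1 by rewrite ln_ge0// invf_ge1// ltW.
set l := 1 + ln n%:R + ln delta^-1 + u.
have l1 : 1 <= l by rewrite /l; lra.
have lu : u <= l by rewrite /l; lra.
set mx := Num.max _ _.
have [x2 x3 x1 lx] := maxr_scale_bounds n0 e0 e1.
rewrite -/mx -/u in x2 x3 x1 lx.
set x := n%:R^-1 * mx in x1 x2 lx.
have nx : n%:R * x = mx by rewrite mulrA divff ?mul1r// gt_eqF.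
set cc := c L D B.
have cc1 : 1 <= cc.
  by rewrite /cc /c -addrA lerDl addr_ge0// !mulr_ge0 ?sqrtr_ge0// ltW.
have y1 : 1 <= cc * l * x.
  rewrite -[leLHS]mulr1; apply: ler_pM => //.
  by rewrite -[leLHS]mulr1; apply: ler_pM.
have [k [k1 k2]] := exists_block y1.
have kl : k.+1%:R <= 53 * cc * l.
  by apply: (block_index_le cc1 l1 x1 _ k2); lra.
have aE t : alpha t = alpha_sc n L F eta eps delta (trunc_log 2 t.+1).
  by apply: halpha; exact: (block_of_epoch t).1.
have a0 t : 0 < alpha t by rewrite aE; exact: alpha_sc_gt0.
have aL t : alpha t * n%:R * L <= 4^-1 by rewrite aE; exact: alpha_sc_le.
have stepsum : D < \sum_(t < blockT k.+1) alpha t * n%:R * (eta * eps) ^+ 2 / 8.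
  have prog := @block_progress R n L F D eta eps delta cc l x k n0 L0 F0 D0 e0
    d0 d1 (lexx _) (ell_blk_le k n0 d0 d1 u0) l1 x2.
  rewrite nx in prog; apply: lt_le_trans (prog x3 k1) _.
  have assoc a : a * n%:R * (eta * eps) ^+ 2 / 8 =
      a * (n%:R * (eta * eps) ^+ 2 / 8) by rewrite !mulrA.
  rewrite assoc; under eq_bigr do rewrite assoc.
  apply: block_sum_ge => //; last exact: halpha.
  by rewrite divr_ge0// mulr_ge0 ?sqr_ge0.
pose ell t := ell_blk n delta (trunc_log 2 t.+1).
pose w := Num.sqrt (n%:R * cstA L * F).
pose dev y j := grad (f j) y - mean_grad f y.
pose xh t (h : t.-tuple 'S_n) := rr_iter f alpha (nth 1%g h) x0 t.
(* Empty where [favg f] exceeds its initial value, since [sum_sqr_dev_le] controls the deviations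
   only below it; [run_stops] asks for no more. *)
pose Bt t (h : t.-tuple 'S_n) := if favg f (xh t h) <= favg f x0
  then bad_orders (dev (xh t h)) (4 * w * ell t) else finset.set0.
pose p t := 2 * n%:R * n.+1%:R * expR (- (2 * ell t)).
apply: (@probability_ge_union_bound _ _ _ _ _
  (fun t => [set w | perms t w \in Bt t (history perms t w)]) p delta
  (blockT k.+1)).
- exact: (@measurable_tau_le _ _ _ _ _ _ _ P).
- by move=> t; exact: (measurable_bad_epoch (Bt t) hP).
- move=> t _; apply: (probability_bad_epoch hP) => h; rewrite /Bt.
  have p0 : 0 <= p t by rewrite !mulr_ge0 ?expR_ge0.
  case: ifP => hx; last by rewrite cards0 mulr_ge0.
  apply: card_bad_orders; [exact: sqrtr_ge0|exact: sum_grad_dev|].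
  rewrite sqr_sqrtr; first exact: sum_sqr_dev_le.
  by apply: mulr_ge0 => //; apply: mulr_ge0 => //; exact: ltW.
- apply: (@le_trans _ _ (\sum_(t < blockT k.+1) delta / (t.+1%:R * t.+2%:R))).
    by apply: ler_sum => t _; exact: bad_epoch_prob_le.
  by rewrite -mulr_sumr -[leRHS]mulr1 ler_pM2l// sum_telescope_inv.
(* Outside the bad events the argument is deterministic: [run_stops] yields a stopping epoch before
   [T_(k+1)]. *)
move=> om good.
have [t tT gt] : exists2 t, (t < blockT k.+1)%N &
    enorm (rr_g f alpha (perms^~ om) x0 t) <= eta * eps.
  apply: (run_stops n0 L0 (ltW e0) df lip hfbar a0 aL _ stepsum).
  move=> t tT xt i iltn.
  have xE : xh t (history perms t om) = rr_iter f alpha (perms^~ om) x0 t.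
    by apply: rr_iter_ext => j jt; exact: nth_history.
  have := good t tT; rewrite /= /Bt xE xt inE => h.
  have {h}h : enorm (prefix_dev (dev (rr_iter f alpha (perms^~ om) x0 t))
      (perms t om) i) <= 4 * w * ell t.
    rewrite leNgt; apply/negP => hi; apply: h.
    by apply/existsP; exists (Ordinal iltn).
  apply: le_trans (alpha_sc_dev (trunc_log 2 t.+1) n0 L0 F0 e0 d0 d1).
  by rewrite -aE ler_pM2l// mulr_gt0.
apply/(rr_tau_le f alpha (perms^~ om) x0 (eta * eps) _ n0).
exists t; split=> //.
have tk : t%:R <= 2 * 2 ^+ k :> R.
  rewrite -exprS -natrX ler_nat; apply: leq_trans (ltnW tT) _.
  by rewrite blockTE leq_pred.
have y0 : 0 < cc * l * x := lt_le_trans ltr01 y1.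
apply: (@le_trans _ _ (n%:R * (2 * (2 * (53 * cc * l * (cc * l * x)))))).
  rewrite ler_pM2l//; apply: le_trans tk _; rewrite ler_pM2l//.
  by apply: le_trans k2 _; rewrite ler_pM2l// ler_pM2r.
rewrite -nx le_eqVlt; apply/orP; left; apply/eqP.
by ring.
Qed.
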